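(* Let $K$ be an algebraically closed field of characteristic zero, $l\in\mathbb{N}$, let $m,n\in\mathbb{N}$ be coprime with $m,n>1$, and let $P,Q\in L^{(l)}$ with $$[P,Q]\in K^\times\quad\text{and}\quad \frac{v_{1,1}(P)}{v_{1,1}(Q)}=\frac{v_{0,1}(P)}{v_{0,1}(Q)}=\frac mn .$$ Assume that $(\rho_0,\sigma_0)\in\mathfrak{V}_{\ge0}$ satisfies: (1) $(\rho_0,\sigma_0)\in\mathrm{Dir}(P)$ and $v_{\rho_0,\sigma_0}(P)>0$; (2) $\frac1m\mathrm{st}_{\rho_0,\sigma_0}(P)=\frac1n\mathrm{st}_{\rho_0,\sigma_0}(Q)\in\frac1l\mathbb{Z}\times\mathbb{N}$; (3) $b<a/l$, where $(a/l,b):=\frac1m\mathrm{st}_{\rho_0,\sigma_0}(P)$. Let $I_1:=[(0,-1),(\rho_0,\sigma_0)]$ and $$(\tilde\rho,\tilde\sigma):=\min\{(\rho,\sigma)\in\mathrm{Dir}(P)\cap I_1: v_{\rho',\sigma'}(P)>0\text{ for all }(\rho_0,\sigma_0)\ge(\rho',\sigma')\ge(\rho,\sigma)\}.$$ Let $F\in L^{(l)}$ be a $(\rho_0,\sigma_0)$-homogeneous element and $G_0\in K[P,Q]\setminus\{0\}$ such that $$v_{\rho_0,\sigma_0}(F)=\rho_0+\sigma_0,\quad [F,\ell_{\rho_0,\sigma_0}(P)]=\ell_{\rho_0,\sigma_0}(P),\quad [\ell_{\rho_0,\sigma_0}(G_0),\ell_{\rho_0,\sigma_0}(P)]\,F=\ell_{\rho_0,\sigma_0}(G_0)\,\ell_{\rho_0,\sigma_0}(P),$$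 and such that, setting recursively $G_i:=[G_{i-1},P]$, one has $[\ell_{\rho_0,\sigma_0}(G_i),\ell_{\rho_0,\sigma_0}(P)]=0$ for all $i\ge1$. If there exist coprime $p,q\in\mathbb{N}$ such that $\mathrm{st}_{\rho_0,\sigma_0}(F)=\frac pq(a/l,b)$, then for all $(\rho,\sigma)\in\mathfrak{V}$ with $(\tilde\rho,\tilde\sigma)\le(\rho,\sigma)<(\rho_0,\sigma_0)$ there exists a $(\rho,\sigma)$-homogeneous element $R\in L^{(l)}$ such that $\ell_{\rho,\sigma}(P)=R^{qm}$.
   Context: $\mathbb{N}$ is the set of positive integers. $L^{(l)}=K[x^{1/l},x^{-1/l},y]$, and $[P,Q]:=\partial_xP\,\partial_yQ-\partial_xQ\,\partial_yP$ for $P,Q\in L^{(l)}$. $K[P,Q]$ is the $K$-subalgebra generated by $P,Q$. Directions: $\mathfrak{V}=\{(\rho,\sigma)\in\mathbb{Z}^2:\gcd(\rho,\sigma)=1\}$, $\mathfrak{V}_{\ge0}=\{(\rho,\sigma)\in\mathfrak{V}:\rho+\sigma\ge0\}$. Identifying a direction with its unit vector in $S^1$, an interval in $\mathfrak{V}$ is the preimage of an arc that is not the whole circle, ordered increasingly counterclockwise; $[A,B]$ is the closed arc going counterclockwise from $A$ to $B$, and the inequalities in the claim refer to the order of $I_1$. For $(\rho,\sigma)\in\mathfrak{V}$ and $P=\sum a_{i/l,j}x^{i/l}y^j\ne0$: $\mathrm{Supp}(P)=\{(i/l,j):a_{i/l,j}\neq0\}$, $v_{\rho,\sigma}(i/l,j)=\rho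 i/l+\sigma j$, $v_{\rho,\sigma}(P)=\max v_{\rho,\sigma}$ over $\mathrm{Supp}(P)$, and $\ell_{\rho,\sigma}(P)$ is the sum of the terms of $P$ attaining this maximum; $v_{\rho,\sigma}(0)=-\infty$, $\ell_{\rho,\sigma}(0)=0$. $P$ is $(\rho,\sigma)$-homogeneous if $P=\ell_{\rho,\sigma}(P)$. $\mathrm{Dir}(P)=\{(\rho,\sigma)\in\mathfrak{V}:\#\mathrm{Supp}(\ell_{\rho,\sigma}(P))>1\}$. With $(a_1,a_2)\times(b_1,b_2)=a_1b_2-a_2b_1$: if $\ell_{\rho,\sigma}(P)$ is a monomial, $\mathrm{st}_{\rho,\sigma}(P)=\mathrm{en}_{\rho,\sigma}(P)$ is its exponent; otherwise they are the two endpoints of the segment spanned by $\mathrm{Supp}(\ell_{\rho,\sigma}(P))$, ordered so that $(\rho,\sigma)\times(\mathrm{en}_{\rho,\sigma}(P)-\mathrm{st}_{\rho,\sigma}(P))>0$. *)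

(* Defs.v *)
From HB Require Import structures.
From mathcomp Require Import all_boot all_order all_algebra.
From mathcomp Require Import finmap.
From mathcomp.multinomials Require Import monalg.
From mathcomp Require Import constructive_ereal.
From mathcomp Require Import ring.

Set Implicit Arguments.
Unset Strict Implicit.
Unset Printing Implicit Defensive.

Import Order.TTheory GRing.Theory Num.Theory.
Local Open Scope fset_scope.
Local Open Scope ring_scope.

(* [puiseux l K] is the algebra K[x^(1/l), x^(-1/l), y], spanned over K by the
   monomials << (i, j) >> = x^(i/l) y^j.  Note that [{malg K[int * nat]}] has no
   library ring structure: keys of a monoid algebra may not have inverses. *)
Definition puiseux (l : nat) (K : nzRingType) : Type := {malg K[(int * nat)%type]}.

Section PuiseuxRing.
Context (l : nat) (K : comNzRingType).
Local Notation L := (puiseux l K).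

HB.instance Definition _ := GRing.Lmodule.on L.

Implicit Types (P Q : L) (e f : int * nat) (c : K).

Definition pone : L := << (0, 0%N) >>.

Definition pmul P Q : L :=
  \sum_(e <- msupp P) \sum_(f <- msupp Q)
    << P@_e * Q@_f *g (e.1 + f.1, (e.2 + f.2)%N) >>.

Local Notation "e +e f" := (e.1 + f.1, (e.2 + f.2)%N) (at level 50).

Lemma pmulw (d1 d2 : {fset (int * nat)%type}) P Q :
  msupp P `<=` d1 -> msupp Q `<=` d2 ->
  pmul P Q = \sum_(e <- d1) \sum_(f <- d2) << P@_e * Q@_f *g e +e f >>.
Proof.
move=> le1 le2; rewrite /pmul (big_fset_incl _ le1) /=.
  apply/eq_bigr=> e _; apply/big_fset_incl => // f _ /mcoeff_outdom ->.
  by rewrite mulr0 monalgU0.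
move=> e _ /mcoeff_outdom Pe.
by rewrite big1 => // f _; rewrite Pe mul0r monalgU0.
Qed.

Lemma pmulC : commutative pmul.
Proof.
move=> P Q; rewrite /pmul exchange_big /=; apply: eq_bigr => e _.
by apply: eq_bigr => f _; rewrite mulrC addrC addnC.
Qed.

Lemma pmulDl : left_distributive pmul +%R.
Proof.
move=> P1 P2 Q; have sQ : msupp Q `<=` msupp Q by [].
rewrite (pmulw (msuppD_le P1 P2) sQ) (pmulw (fsubsetUl _ (msupp P2)) sQ).
rewrite (pmulw (fsubsetUr (msupp P1) _) sQ) -big_split /=.
apply: eq_bigr => e _; rewrite -big_split /=; apply: eq_bigr => f _.
by rewrite mcoeffD mulrDl monalgUD.
Qed.

Lemma pmulDr : right_distributive pmul +%R.
Proof. by move=> P Q1 Q2; rewrite pmulC pmulDl !(pmulC P). Qed.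

Lemma pmul0 : left_zero 0 pmul.
Proof. by move=> P; rewrite /pmul msupp0 big_seq_fset0. Qed.

Lemma pmulr0 : right_zero 0 pmul.
Proof. by move=> P; rewrite pmulC pmul0. Qed.

Lemma pmulUU c1 c2 e f :
  pmul << c1 *g e >> << c2 *g f >> = << c1 * c2 *g e +e f >>.
Proof.
by rewrite (pmulw msuppU_le msuppU_le) !big_seq_fset1 !mcoeffUU.
Qed.

Lemma pmul_suml (I : Type) (r : seq I) (F : I -> L) Q :
  pmul (\sum_(i <- r) F i) Q = \sum_(i <- r) pmul (F i) Q.
Proof. exact: (big_morph (pmul^~ Q) (fun _ _ => pmulDl _ _ _) (pmul0 Q)). Qed.

Lemma pmul_sumr (I : Type) (r : seq I) (F : I -> L) P :
  pmul P (\sum_(i <- r) F i) = \sum_(i <- r) pmul P (F i).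
Proof. exact: (big_morph (pmul P) (fun _ _ => pmulDr _ _ _) (pmulr0 P)). Qed.

Lemma pmulA : associative pmul.
Proof.
have E P Q : pmul P Q =
    \sum_(e <- msupp P) \sum_(f <- msupp Q)
      pmul << P@_e *g e >> << Q@_f *g f >>.
  by apply: eq_bigr => e _; apply: eq_bigr => f _; rewrite pmulUU.
have El P Q : pmul P Q = \sum_(e <- msupp P) pmul << P@_e *g e >> Q.
  by rewrite {1}[P]monalgE pmul_suml.
have Er P Q : pmul P Q = \sum_(f <- msupp Q) pmul P << Q@_f *g f >>.
  by rewrite {1}[Q]monalgE pmul_sumr.
move=> P Q R; rewrite [LHS]El (El P Q) pmul_suml; apply: eq_bigr => e _.
rewrite (E Q R) (Er _ Q) pmul_sumr pmul_suml; apply: eq_bigr => f _.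
rewrite pmul_sumr [RHS]Er; apply: eq_bigr => g _.
by rewrite !pmulUU /= mulrA addrA addnA.
Qed.

Lemma pmul1 : left_id pone pmul.
Proof.
move=> P; rewrite [P in LHS]monalgE [RHS]monalgE pmul_sumr.
by apply: eq_bigr => -[i j] _; rewrite pmulUU /= mul1r add0r.
Qed.

Lemma pone_neq0 : pone != 0.
Proof. by rewrite monalgU_eq0 oner_eq0. Qed.

HB.instance Definition _ := GRing.Zmodule_isComNzRing.Build L
  pmulA pmulC pmul1 pmulDl pone_neq0.

Lemma pscaleAl c P Q : c *: (P * Q) = (c *: P) * Q.
Proof.
have Z d (A : L) : d *: A = pmul << d *g (0, 0%N) >> A.
  apply/malgP => k; rewrite [A in RHS]monalgE pmul_sumr mcoeffZ.
  rewrite {1}[A]monalgE !raddf_sum mulr_sumr /=; apply: eq_bigr => -[i j] _.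
  by rewrite pmulUU /= add0r !mcoeffU mulrnAr.
by rewrite !Z -[LHS]/(pmul _ (pmul _ _)) pmulA.
Qed.

HB.instance Definition _ := GRing.Lmodule_isLalgebra.Build K L pscaleAl.
HB.instance Definition _ := GRing.Lalgebra_isComAlgebra.Build K L.

End PuiseuxRing.

(* [subalg_gen P Q] is the K-subalgebra K[P, Q]. *)
Inductive subalg_gen (K : nzRingType) (A : lalgType K) (P Q : A) : A -> Prop :=
| Gen_l : subalg_gen P Q P
| Gen_r : subalg_gen P Q Q
| Gen_scalar (c : K) : subalg_gen P Q c%:A
| Gen_add (R S : A) :
    subalg_gen P Q R -> subalg_gen P Q S -> subalg_gen P Q (R + S)
| Gen_mul (R S : A) :
    subalg_gen P Q R -> subalg_gen P Q S -> subalg_gen P Q (R * S).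

Definition pt : Type := (rat^o * rat^o)%type.

Definition cross (R : pzRingType) (u v : R * R) : R := u.1 * v.2 - u.2 * v.1.
Definition dot (R : pzRingType) (u v : R * R) : R := u.1 * v.1 + u.2 * v.2.

Definition is_dir (u : int * int) : bool := coprimez u.1 u.2.
Definition is_dir_ge0 (u : int * int) : bool := is_dir u && (0 <= u.1 + u.2).
Definition dir_pt (u : int * int) : pt := (u.1%:~R, u.2%:~R).

(* The counterclockwise angle in [0, 2 pi) from [A] to [u] lies in [0, pi). *)
Definition first_half (A u : int * int) : bool :=
  (0 < cross A u) || ((cross A u == 0) && (0 < dot A u)).

(* Directions compared by their counterclockwise angle in [0, 2 pi) from [A]:
   this is the order of any arc that starts at [A]. *)
Definition ccw_le (A u v : int * int) : bool :=
  if first_half A u == first_half A v then 0 <= cross u v else first_half A u.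
Definition ccw_lt (A u v : int * int) : bool := (u != v) && ccw_le A u v.

Definition ccw_arc (A B : int * int) : pred (int * int) :=
  [pred u | is_dir u & ccw_le A u B].

Section Leading.
Context (l : nat) (K : fieldType).
Local Notation L := (puiseux l K).
Implicit Types (P Q : L) (e : int * nat) (u : int * int).

Definition dx P : L :=
  \sum_(e <- msupp P) << e.1%:~R / l%:R * P@_e *g (e.1 - l%:Z, e.2) >>.

(* For [e.2 = 0] the coefficient is 0, so the truncation of [e.2.-1] is
   harmless. *)
Definition dy P : L :=
  \sum_(e <- msupp P) << e.2%:R * P@_e *g (e.1, e.2.-1) >>.

Definition bracket P Q : L := dx P * dy Q - dx Q * dy P.

Definition expo e : pt := (e.1%:~R / l%:R, e.2%:R).

Definition Supp P : {fset pt} := [fset expo e | e in msupp P].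

Definition wt u (z : pt) : rat := u.1%:~R * z.1 + u.2%:~R * z.2.

(* [vdeg u 0 = -oo].  In an equation [fine (vdeg u P) / fine (vdeg u Q) = c] with
   [c != 0] the convention [x / 0 = 0] forces both degrees to be nonzero. *)
Definition vdeg u P : \bar rat := \big[maxe/-oo%E]_(z <- Supp P) (wt u z)%:E.

Definition lead u P : L :=
  \sum_(e <- msupp P | (wt u (expo e))%:E == vdeg u P) << P@_e *g e >>.

Definition homogeneous u P : Prop := P = lead u P.

Definition Dir P : pred (int * int) :=
  [pred u | is_dir u & (1 < #|` Supp (lead u P)|)%N].

(* [Supp (lead u P)] lies on a line orthogonal to [u], on which [cross u] is
   an affine coordinate; [st_en_spec] below justifies the definitions. *)
Definition edge u P : seq pt :=
  sort (fun z w => cross (dir_pt u) z <= cross (dir_pt u) w) (Supp (lead u P)).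
Definition st u P : pt := head 0 (edge u P).
Definition en u P : pt := last 0 (edge u P).

Lemma vdeg_attained u P :
  P != 0 -> exists2 e, e \in msupp P & (wt u (expo e))%:E = vdeg u P.
Proof.
move=> P0; have [e0 Pe0] : exists e, e \in msupp P.
  apply/fset0Pn; apply: contraNneq P0 => s0; apply/eqP/malgP => e.
  by rewrite mcoeff0 mcoeff_outdom // s0.
have: expo e0 \in Supp P by apply: in_imfset.
have H (s : seq pt) z : z \in s -> exists2 z' : pt, z' \in s &
    (wt u z')%:E = \big[maxe/-oo%E]_(z <- s) (wt u z)%:E.
  elim: s z => // z1 s IH z _; rewrite big_cons.
  case: s IH => [_|z2 s IH].
    by exists z1; rewrite ?mem_head // big_nil maxeNy.
  have [z' z's <-] := IH z2 (mem_head _ _).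
  case: (leP (wt u z1) (wt u z')) => h.
    by exists z'; [rewrite in_cons z's orbT | rewrite max_r // lee_fin].
  by exists z1; [rewrite mem_head | rewrite max_l // lee_fin ltW].
by rewrite /vdeg => /H[z' /imfsetP[e /= Pe ->] <-]; exists e.
Qed.

Lemma mcoeff_lead u P e :
  (lead u P)@_e = if (wt u (expo e))%:E == vdeg u P then P@_e else 0.
Proof.
rewrite /lead big_mkcond raddf_sum /=.
have [Pe|nPe] := boolP (e \in msupp P); last first.
  rewrite mcoeff_outdom // if_same big_seq big1 // => f Pf.
  case: ifP => _; rewrite ?mcoeff0 // mcoeffU.
  by case: eqP => // fe; rewrite -fe Pf in nPe.
rewrite (big_fsetD1 e) //= big1_fset ?addr0; last first.
  move=> f /fsetD1P[nef _] _; case: ifP => _; rewrite ?mcoeff0 //.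
  by rewrite mcoeffU (negbTE nef).
by case: ifP => _; rewrite ?mcoeff0 // mcoeffUU.
Qed.

Lemma Supp_lead u P z :
  z \in Supp (lead u P) -> (wt u z)%:E = vdeg u P.
Proof.
move=> /imfsetP[e /= + ->]; rewrite -mcoeff_neq0 mcoeff_lead.
by case: ifP => [/eqP //|]; rewrite eqxx.
Qed.

Lemma Supp_lead_neq0 u P : P != 0 -> Supp (lead u P) != fset0.
Proof.
move=> /(vdeg_attained u)[e Pe ve]; apply/fset0Pn; exists (expo e).
by apply: in_imfset; rewrite /= -mcoeff_neq0 mcoeff_lead ve eqxx mcoeff_neq0.
Qed.

Lemma st_en_spec u P : is_dir u -> P != 0 ->
  let S := Supp (lead u P) in
  [/\ st u P \in S, en u P \in S,
      #|` S| = 1%N -> st u P = en u P,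
      (1 < #|` S|)%N -> 0 < cross (dir_pt u) (en u P - st u P) &
      forall z, z \in S -> exists2 t : rat,
        0 <= t <= 1 & z = st u P + t *: (en u P - st u P)].
Proof.
move=> du P0 S; set s := st u P; set f := en u P; pose U := dir_pt u.
pose r := fun z w : pt => cross U z <= cross U w.
have rT : transitive r by move=> y x z; exact: le_trans.
have srt : sorted r (edge u P) by apply: sort_sorted => x y; exact: le_total.
have memE z : (z \in edge u P) = (z \in S) by rewrite mem_sort.
have [z0 z0S] : exists z, z \in S by apply/fset0Pn/Supp_lead_neq0.
have E0 : (0 < size (edge u P))%N.
  by case: (edge u P) (memE z0) => //; rewrite z0S.
have sE : s = nth 0 (edge u P) 0 by rewrite nth0.
have fE : f = nth 0 (edge u P) (size (edge u P)).-1 by rewrite nth_last.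
have sS : s \in S by rewrite -memE sE mem_nth.
have fS : f \in S by rewrite -memE fE mem_nth // prednK.
have mono i j : (i <= j < size (edge u P))%N ->
    cross U (nth 0 (edge u P) i) <= cross U (nth 0 (edge u P) j).
  move=> /andP[ij jE]; apply: (sorted_leq_nth rT) => //; rewrite ?inE //.
    by move=> x; rewrite /r lexx.
  exact: leq_ltn_trans jE.
have bnd z : z \in S -> cross U s <= cross U z <= cross U f.
  rewrite -memE => zE; rewrite -(nth_index 0 zE) sE fE.
  by rewrite !mono //= ?index_mem // -ltnS prednK // index_mem zE /=.
have U0 : dot U U != 0.
  apply: contraL du => /eqP; rewrite /dot /= /is_dir => /eqP.
  rewrite -!expr2 paddr_eq0 ?sqr_ge0 // !sqrf_eq0 !intr_eq0.
  by case: u {s f U r rT srt memE sE fE mono bnd z0S E0 sS fS S} => a b /=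
    /andP[/eqP-> /eqP->].
have wtS z w : z \in S -> w \in S -> wt u z = wt u w.
  by move=> /Supp_lead zv /Supp_lead; rewrite -zv => -[].
have inj2 z w : wt u z = wt u w -> cross U z = cross U w -> z = w.
  rewrite /wt /cross /= => h1 h2.
  case: z w h1 h2 => [z1 z2] [w1 w2] /= h1 h2; rewrite /dot /= in U0.
  congr pair; apply: (mulfI U0).
    have -> : (u.1%:~R * u.1%:~R + u.2%:~R * u.2%:~R) * z1 =
      u.1%:~R * (u.1%:~R * z1 + u.2%:~R * z2)
      - u.2%:~R * (u.1%:~R * z2 - u.2%:~R * z1) :> rat by ring.
    by rewrite h1 h2; ring.
  have -> : (u.1%:~R * u.1%:~R + u.2%:~R * u.2%:~R) * z2 =
    u.2%:~R * (u.1%:~R * z1 + u.2%:~R * z2)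
    + u.1%:~R * (u.1%:~R * z2 - u.2%:~R * z1) :> rat by ring.
  by rewrite h1 h2; ring.
have inj z w : z \in S -> w \in S -> cross U z = cross U w -> z = w.
  by move=> zS wS; apply: inj2; exact: wtS.
have crB z w : cross U (z - w) = cross U z - cross U w.
  by rewrite /cross /=; ring.
split=> //.
- by move=> /eqP/cardfs1P[z Sz]; move: sS fS; rewrite Sz !inE => /eqP-> /eqP->.
- move=> S1; rewrite crB subr_gt0 lt_neqAle.
  have /andP[-> _] := bnd _ fS; rewrite andbT; apply: contraTneq S1 => sf.
  rewrite -leqNgt -(cardfs1 s) fsubset_leq_card //; apply/fsubsetP => z zS.
  rewrite inE; apply/eqP/inj => //; apply/le_anti.
  by case/andP: (bnd _ zS); rewrite sf => -> ->.
move=> z zS; have [sf|sf] := eqVneq s f.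
  exists 0; rewrite ?lexx ?ler01 // scale0r addr0; apply: inj => //.
  by apply/le_anti; case/andP: (bnd _ zS); rewrite -sf => -> ->.
have csf : 0 < cross U f - cross U s.
  rewrite subr_gt0 lt_neqAle; have /andP[-> _] := bnd _ fS.
  by rewrite andbT; apply: contraNneq sf => /inj->.
set t := (cross U z - cross U s) / (cross U f - cross U s).
exists t.
  have /andP[h1 h2] := bnd _ zS.
  by rewrite divr_ge0 ?subr_ge0 ?(ltW csf) ?(le_trans h1) //=
     ler_pdivrMr // mul1r lerD2r.
apply: inj2.
  have -> : wt u (s + t *: (f - s)) = wt u s + t * (wt u f - wt u s).
    rewrite /wt -[(s + _).1]/(s.1 + t * (f.1 - s.1))
      -[(s + _).2]/(s.2 + t * (f.2 - s.2)).
    by ring.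
  by rewrite (wtS f s) // subrr mulr0 addr0; exact: wtS.
have -> : cross U (s + t *: (f - s)) =
    cross U s + t * (cross U f - cross U s).
  rewrite /cross -[(s + _).1]/(s.1 + t * (f.1 - s.1))
    -[(s + _).2]/(s.2 + t * (f.2 - s.2)).
  by ring.
by rewrite divfK ?(gt_eqF csf) // addrC subrK.
Qed.


End Leading.

Definition is_min_dir (A : int * int) (D : int * int -> Prop) (u : int * int) :=
  D u /\ forall w, D w -> ccw_le A u w.

(* Main.v *)
(* Let A = st(P) / m = (a/l, b), where st is taken at u0, and let G_i be the
   iterated brackets of G0 with P.  Bracketing with P is locally nilpotent on
   K[P, Q], so that G_0, ..., G_N are nonzero and G_(N+1) = 0.  At u0 the points
   st(Q) and st(G_i) are multiples of A: for i >= 1 because the leading forms of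
   G_i and P commute, for i = 0 because otherwise st(F) = (1, 1), which does not
   lie below the diagonal.

   This propagates clockwise.  If v_w(G) = t v_w(P) and the leading forms of G and
   P at w commute, then st_w(G) = t st_w(P), so that v(G) = t v(P) up to the next
   edge of P or G.  If the leading forms did not commute, then
   v_w([G, P]) = v_w(G) + v_w(P) - w.(1, 1); by descending induction v([G, P]) is
   also a multiple of v(P), so w.(1, 1) = d v_w(P) for a constant d.  But
   [G, P] has degree at most v(G) + v(P) - u0.(1, 1) at u0, so
   u0.(1, 1) <= d v_u0(P), and as A is below the diagonal this gives
   w.(1, 1) < d v_w(P) for w clockwise from u0.

   At u the leading forms S, T, G, H of P, Q, G_0, G_1 thus commute, and commuting
   homogeneous elements of the same nonzero degree are proportional.  Hence S^n is
   proportional to T^m, so S to some M^m; and st(G_1) = st(G_0) + st(P) - st(F)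
   makes (G S)^q proportional to M^p H^q, so M is proportional to a q-th power.
   The roots exist because a homogeneous element is a monomial times a polynomial
   in one monomial. *)
Require Import Defs.
From mathcomp Require Import all_boot all_order all_algebra.
From mathcomp Require Import finmap.
From mathcomp.multinomials Require Import monalg.
From mathcomp Require Import constructive_ereal.
From mathcomp Require Import ring lra zify.

Set Implicit Arguments.
Unset Strict Implicit.
Unset Printing Implicit Defensive.

Import Order.TTheory GRing.Theory Num.Theory.
Local Open Scope ring_scope.

(* Reasoning over an abstract [L] keeps the monoid algebra behind [puiseux] from
   being unfolded during unification. *)
Record laurent_model (l : nat) (K : fieldType) (L : comAlgType K) := LaurentModel {
  coef : L -> int * nat -> K;
  mono : int * nat -> L;
  supp : L -> seq (int * nat);
  dX : L -> L;
  dY : L -> L;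
  coefP : forall c P Q k, coef (c *: P + Q) k = c * coef P k + coef Q k;
  coef_inj : forall P Q, coef P =1 coef Q -> P = Q;
  supp_uniq : forall P, uniq (supp P);
  mem_supp : forall P e, (e \in supp P) = (coef P e != 0);
  coef_mono : forall e k, coef (mono e) k = (e == k)%:R;
  mono1 : mono (0, 0%N) = 1;
  monoM : forall e f, mono e * mono f = mono (e.1 + f.1, (e.2 + f.2)%N);
  coef_dX : forall P k,
    coef (dX P) k = (k.1 + l%:Z)%:~R / l%:R * coef P (k.1 + l%:Z, k.2);
  coef_dY : forall P k, coef (dY P) k = k.2.+1%:R * coef P (k.1, k.2.+1) }.

Arguments coef_inj {l K L} _ {P Q}.

(** * Monomial expansions, partial derivatives and the Jacobian bracket in an abstract model *)

Section Model.
Context (l : nat) (K : fieldType) (L : comAlgType K) (M : laurent_model l L).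
Implicit Types (P Q R S : L) (e f g : int * nat) (c : K).
Local Notation coef := (coef M).
Local Notation mono := (mono M).
Local Notation supp := (supp M).
Local Notation dX := (dX M).
Local Notation dY := (dY M).

Lemma coef0 e : coef 0 e = 0.
Proof.
have := coefP M 1 0 0 e; rewrite scale1r addr0 mul1r => /esym/eqP.
by rewrite -subr_eq0 addrK => /eqP.
Qed.

Lemma coefD P Q e : coef (P + Q) e = coef P e + coef Q e.
Proof. by have := coefP M 1 P Q e; rewrite scale1r mul1r. Qed.

Lemma coefZ c P e : coef (c *: P) e = c * coef P e.
Proof. by have := coefP M c P 0 e; rewrite !addr0 coef0 addr0. Qed.

Lemma coefN P e : coef (- P) e = - coef P e.
Proof. by rewrite -scaleN1r coefZ mulN1r. Qed.

Lemma coefB P Q e : coef (P - Q) e = coef P e - coef Q e.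
Proof. by rewrite coefD coefN. Qed.

Lemma coef_sum (I : Type) (r : seq I) (F : I -> L) e :
  coef (\sum_(i <- r) F i) e = \sum_(i <- r) coef (F i) e.
Proof.
by elim: r => [|i r IH]; rewrite ?big_nil ?coef0 // !big_cons coefD IH.
Qed.

Lemma supp0 P : P != 0 -> exists e, coef P e != 0.
Proof.
move=> P0; case E: (supp P) => [|e s].
  case/eqP: P0; apply: (coef_inj M) => e; rewrite coef0; apply/eqP.
  by rewrite -[_ == _]negbK -mem_supp E.
by exists e; rewrite -mem_supp E mem_head.
Qed.

Lemma coef_expand P : P = \sum_(e <- supp P) coef P e *: mono e.
Proof.
apply: (coef_inj M) => k; rewrite coef_sum.
rewrite (eq_bigr (fun e => coef P e * (e == k)%:R)); last first.
  by move=> e _; rewrite coefZ coef_mono.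
have [kP|kP] := boolP (k \in supp P).
  rewrite (bigD1_seq k) ?supp_uniq //= eqxx mulr1 big1 ?addr0 // => e /negbTE ->.
  by rewrite mulr0.
rewrite big_seq big1; first by apply/eqP; rewrite -[_ == _]negbK -mem_supp.
by move=> e eP; case: eqP eP kP => [-> -> //|]; rewrite mulr0.
Qed.

Lemma model_ind (Pr : L -> Prop) :
  Pr 0 -> (forall c e P, Pr P -> Pr (c *: mono e + P)) -> forall P, Pr P.
Proof.
move=> P0 PS P; rewrite [P]coef_expand.
by elim: (supp P) => [|e r IH]; rewrite ?big_nil ?big_cons //; apply: PS.
Qed.

Lemma mono_neq0 e : mono e != 0.
Proof.
apply/eqP => /(congr1 (coef^~ e)); rewrite coef_mono eqxx coef0 => /eqP.
by rewrite oner_eq0.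
Qed.

Lemma dXD P Q : dX (P + Q) = dX P + dX Q.
Proof. by apply: (coef_inj M) => k; rewrite !(coef_dX, coefD) mulrDr. Qed.

Lemma dYD P Q : dY (P + Q) = dY P + dY Q.
Proof. by apply: (coef_inj M) => k; rewrite !(coef_dY, coefD) mulrDr. Qed.

Lemma dXZ c P : dX (c *: P) = c *: dX P.
Proof. by apply: (coef_inj M) => k; rewrite !(coef_dX, coefZ) mulrCA. Qed.

Lemma dYZ c P : dY (c *: P) = c *: dY P.
Proof. by apply: (coef_inj M) => k; rewrite !(coef_dY, coefZ) mulrCA. Qed.

Lemma dX0 : dX 0 = 0. Proof. by rewrite -(scale0r 0) dXZ !scale0r. Qed.
Lemma dY0 : dY 0 = 0. Proof. by rewrite -(scale0r 0) dYZ !scale0r. Qed.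

Lemma dX_mono e : dX (mono e) = (e.1%:~R / l%:R) *: mono (e.1 - l%:Z, e.2).
Proof.
apply: (coef_inj M) => k; rewrite coef_dX coefZ !coef_mono.
case: e k => e1 e2 [k1 k2] /=; rewrite !xpair_eqE /= subr_eq.
by case: (e1 =P _) => [->|_] //=; rewrite !mulr0.
Qed.

Lemma dY_mono e : dY (mono e) = e.2%:R *: mono (e.1, e.2.-1).
Proof.
apply: (coef_inj M) => k; rewrite coef_dY coefZ !coef_mono.
case: e k => e1 [|e2] [k1 k2] /=; rewrite !xpair_eqE /= ?eqSS.
  by rewrite andbF mulr0 mul0r.
by case: (e2 =P k2) => [->|_]; rewrite ?andbF ?mulr0.
Qed.

Lemma dXM P Q : dX (P * Q) = dX P * Q + P * dX Q.
Proof.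
elim/model_ind: P => [|c e P IH]; first by rewrite !(mul0r, dX0) addr0.
rewrite mulrDl !dXD IH !mulrDl addrACA; congr (_ + _).
elim/model_ind: Q {IH} => [|c' f Q IH]; first by rewrite !(mulr0, dX0) addr0.
rewrite mulrDr !dXD IH !mulrDr addrACA; congr (_ + _).
rewrite -!(scalerAl, scalerAr) monoM !(dXZ, dX_mono) -!(scalerAl, scalerAr) !monoM /=
  !scalerA.
rewrite [e.1 - _ + _]addrAC [e.1 + (_ - _)]addrA -scalerDl.
by congr (_ *: _); rewrite rmorphD /=; ring.
Qed.

Lemma dYM P Q : dY (P * Q) = dY P * Q + P * dY Q.
Proof.
elim/model_ind: P => [|c e P IH]; first by rewrite !(mul0r, dY0) addr0.
rewrite mulrDl !dYD IH !mulrDl addrACA; congr (_ + _).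
elim/model_ind: Q {IH} => [|c' f Q IH]; first by rewrite !(mulr0, dY0) addr0.
rewrite mulrDr !dYD IH !mulrDr addrACA; congr (_ + _).
rewrite -!(scalerAl, scalerAr) monoM !(dYZ, dY_mono) -!(scalerAl, scalerAr) !monoM /=
  !scalerA.
case: e f {IH} => e1 [|e2] [f1 [|f2]] /=;
  rewrite ?(mul0r, mulr0, addn0, add0n, scale0r, addr0, add0r) //.
  by congr (_ *: _); ring.
by rewrite [(e2.+1 + f2)%N]addSnnS -scalerDl; congr (_ *: _); rewrite natrD; ring.
Qed.

Definition brk P Q : L := dX P * dY Q - dX Q * dY P.

Lemma brkC P Q : brk P Q = - brk Q P.
Proof. by rewrite /brk opprB. Qed.
Lemma brkDl P Q R : brk (P + Q) R = brk P R + brk Q R.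
Proof. by rewrite /brk dXD dYD; ring. Qed.
Lemma brkMl P Q R : brk (P * Q) R = P * brk Q R + Q * brk P R.
Proof. by rewrite /brk dXM dYM; ring. Qed.
Lemma brkZl c P R : brk (c *: P) R = c *: brk P R.
Proof. by rewrite /brk dXZ dYZ scalerBr -!scalerAl -!scalerAr. Qed.
Lemma brkMr P Q R : brk R (P * Q) = P * brk R Q + Q * brk R P.
Proof. by rewrite brkC brkMl opprD -!mulrN -!brkC. Qed.
Lemma brkZr c P R : brk R (c *: P) = c *: brk R P.
Proof. by rewrite brkC brkZl -scalerN -brkC. Qed.
Lemma brkPP P : brk P P = 0.
Proof. by rewrite /brk subrr. Qed.
Lemma brk0l P : brk 0 P = 0.
Proof. by rewrite /brk dX0 dY0 !(mul0r, mulr0) subrr. Qed.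
Lemma brk0r P : brk P 0 = 0.
Proof. by rewrite brkC brk0l oppr0. Qed.
Lemma brk1l P : brk 1 P = 0.
Proof.
by have := brkMl 1 1 P; rewrite !mul1r => /esym/eqP; rewrite -subr_eq0 addrK => /eqP.
Qed.

(** When both y-exponents are 0 the scalar vanishes, so the truncation in [(e.2 + f.2).-1] does no
    harm. *)
Lemma brk_mono e f :
  brk (mono e) (mono f) =
  ((e.1%:~R * f.2%:R - f.1%:~R * e.2%:R) / l%:R) *:
     mono (e.1 + f.1 - l%:Z, (e.2 + f.2).-1).
Proof.
have E1 : e.1 - l%:Z + f.1 = e.1 + f.1 - l%:Z by rewrite addrAC.
have E2 : f.1 - l%:Z + e.1 = e.1 + f.1 - l%:Z by rewrite addrAC [f.1 + _]addrC.
rewrite /brk !(dX_mono, dY_mono) -!(scalerAl, scalerAr) !scalerA !monoM /= E1 E2.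
case: e f {E1 E2} => e1 [|e2] [f1 [|f2]] /=;
  rewrite ?(mulr0, scale0r, subrr, mul0r, subr0, sub0r, addn0, add0n, addnS) //=.
- by rewrite !oppr0 mul0r scale0r.
- by congr (_ *: _); ring.
- by rewrite -scaleNr; congr (_ *: _); ring.
by rewrite !addSn [(f2 + e2)%N]addnC -scalerBl; congr (_ *: _); ring.
Qed.

End Model.

(** * Weights and homogeneous parts *)

Section Weights.
Context (l : nat) (l0 : (0 < l)%N) (K : fieldType) (ch0 : [pchar K] =i pred0).
Context (L : comAlgType K) (M : laurent_model l L).
Implicit Types (P Q R S : L) (e f g : int * nat) (c : K) (a b : rat * rat).
Implicit Types (Z : int * nat -> Prop) (d : rat).
Local Notation coef := (coef M).
Local Notation mono := (mono M).
Local Notation supp := (supp M).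
Local Notation dX := (dX M).
Local Notation dY := (dY M).
Local Notation brk := (brk M).

(** The weight vector is rational, not a coprime pair, so that it can move continuously along a
    segment between two directions. *)
Definition wgt a e : rat := a.1 * (e.1%:~R / l%:R) + a.2 * e.2%:R.

Definition supported Z P := forall e, coef P e != 0 -> Z e.

Lemma supported_impl Z1 Z2 P :
  (forall e, Z1 e -> Z2 e) -> supported Z1 P -> supported Z2 P.
Proof. by move=> h h1 e /h1/h. Qed.

Lemma supported0 Z : supported Z 0.
Proof. by move=> e; rewrite coef0 eqxx. Qed.

Lemma supportedD Z P Q : supported Z P -> supported Z Q -> supported Z (P + Q).
Proof.
move=> hP hQ e; rewrite coefD; have [->|/hP //] := eqVneq (coef P e) 0.
by rewrite add0r => /hQ.
Qed.

Lemma supportedZ Z c P : supported Z P -> supported Z (c *: P).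
Proof. by move=> hP e; rewrite coefZ mulf_eq0 => /norP[_ /hP]. Qed.

Lemma supported_mono Z e : Z e -> supported Z (mono e).
Proof. by move=> Ze f; rewrite coef_mono; case: (e =P f) => [<- //|]; rewrite eqxx. Qed.

Lemma supported_sum Z (I : eqType) (r : seq I) (F : I -> L) :
  (forall i, i \in r -> supported Z (F i)) -> supported Z (\sum_(i <- r) F i).
Proof.
move=> h; rewrite big_seq; elim/big_ind: _ => //; first exact: supported0.
by move=> x y; apply: supportedD.
Qed.

Lemma supportedM Z1 Z2 Z P Q :
  (forall e f, Z1 e -> Z2 f -> Z (e.1 + f.1, (e.2 + f.2)%N)) ->
  supported Z1 P -> supported Z2 Q -> supported Z (P * Q).
Proof.
move=> h hP hQ; rewrite (coef_expand M P) (coef_expand M Q) mulr_suml.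
apply: supported_sum => e; rewrite mem_supp => /hP Ze; rewrite mulr_sumr.
apply: supported_sum => f; rewrite mem_supp => /hQ Zf.
by rewrite -!(scalerAl, scalerAr) monoM; do 2!apply: supportedZ; apply: supported_mono;
  apply: h.
Qed.

(** Bounds on weights instead of degrees: they hold for 0 and pass to sums and products without case
    distinctions. *)
Definition ble a d := supported (fun e => wgt a e <= d).
Definition blt a d := supported (fun e => wgt a e < d).
Definition hom a d := supported (fun e => wgt a e = d).

Lemma wgtD a e f : wgt a (e.1 + f.1, (e.2 + f.2)%N) = wgt a e + wgt a f.
Proof. by rewrite /wgt /= rmorphD natrD /=; ring. Qed.

Lemma wgt_lin a b (s t : rat) e :
  wgt (s * a.1 + t * b.1, s * a.2 + t * b.2) e = s * wgt a e + t * wgt b e.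
Proof. by rewrite /wgt /=; ring. Qed.

Lemma homM a d1 d2 P Q : hom a d1 P -> hom a d2 Q -> hom a (d1 + d2) (P * Q).
Proof. by apply: supportedM => e f <- <-; rewrite wgtD. Qed.

Lemma hom1 a : hom a 0 1.
Proof. by rewrite -(mono1 M); apply: supported_mono; rewrite /wgt /=; ring. Qed.

Lemma homX a d P n : hom a d P -> hom a (d * n%:R) (P ^+ n).
Proof.
move=> h; elim: n => [|n IH]; first by rewrite mulr0 expr0; apply: hom1.
by rewrite exprS mulrS mulrDr mulr1; apply: homM.
Qed.

Definition part a d P : L :=
  \sum_(e <- supp P | wgt a e == d) coef P e *: mono e.

Lemma coef_part a d P e :
  coef (part a d P) e = if wgt a e == d then coef P e else 0.
Proof.
rewrite /part big_mkcond coef_sum.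
rewrite (eq_bigr (fun f => (if wgt a f == d then coef P f else 0) * (f == e)%:R)); last
  first.
  by move=> f _; case: ifP => _; rewrite ?coef0 ?mul0r // coefZ coef_mono.
have [eP|eP] := boolP (e \in supp P).
  rewrite (bigD1_seq e) ?supp_uniq //= eqxx mulr1 big1 ?addr0 // => f /negbTE ->.
  by rewrite mulr0.
rewrite big_seq big1; last first.
  by move=> f fP; case: (f =P e) fP eP => [-> -> //|]; rewrite mulr0.
by move: eP; rewrite mem_supp negbK => /eqP ->; rewrite if_same.
Qed.

Lemma partD a d P Q : part a d (P + Q) = part a d P + part a d Q.
Proof.
apply: (coef_inj M) => e; rewrite !(coefD, coef_part).
by case: ifP => //; rewrite addr0.
Qed.

Lemma partN a d P : part a d (- P) = - part a d P.
Proof.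
by apply: (coef_inj M) => e; rewrite !(coefN, coef_part); case: ifP; rewrite ?oppr0.
Qed.

Lemma part_hom a d P : hom a d (part a d P).
Proof. by move=> e; rewrite coef_part; case: (_ =P d) => //; rewrite eqxx. Qed.

Lemma hom_part a d P : hom a d P -> part a d P = P.
Proof.
move=> h; apply: (coef_inj M) => e; rewrite coef_part; case: eqP => // we.
by apply/esym/eqP; apply: contra_notT we => /h.
Qed.

Lemma blt_part a d P : blt a d P -> part a d P = 0.
Proof.
move=> h; apply: (coef_inj M) => e; rewrite coef_part coef0; case: eqP => // we.
by apply/eqP; apply: contraTT isT => /h; rewrite we ltxx.
Qed.

Lemma hom_ble a d P : hom a d P -> ble a d P.
Proof. by apply: supported_impl => e ->. Qed.

Lemma ble_sub_part a d P : ble a d P -> blt a d (P - part a d P).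
Proof.
move=> h e; rewrite coefB coef_part; case: (_ =P d) => [_|/eqP ne]; first by rewrite
  subrr eqxx.
by rewrite subr0 lt_neqAle ne => /h ->.
Qed.

Lemma bleD a d P Q : ble a d P -> ble a d Q -> ble a d (P + Q).
Proof. exact: supportedD. Qed.

Lemma bleN a d P : ble a d P -> ble a d (- P).
Proof. by rewrite -scaleN1r; apply: supportedZ. Qed.

Lemma bleM a d1 d2 P Q : ble a d1 P -> ble a d2 Q -> ble a (d1 + d2) (P * Q).
Proof. by apply: supportedM => e f h1 h2; rewrite wgtD lerD. Qed.

(** Once the components of weight [d1] and [d2] are split off, every remaining product has weight
    strictly below [d1 + d2]. *)
Lemma partM a d1 d2 P Q : ble a d1 P -> ble a d2 Q ->
  part a (d1 + d2) (P * Q) = part a d1 P * part a d2 Q.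
Proof.
move=> hP hQ; set p := part a d1 P; set q := part a d2 Q.
have -> : P * Q = p * q + ((P - p) * Q + p * (Q - q)) by ring.
rewrite partD hom_part; last by apply: homM; apply: part_hom.
rewrite blt_part ?addr0 //; apply: supportedD.
  apply: supportedM (ble_sub_part hP) hQ => e f h1 h2.
  by rewrite wgtD ltr_leD.
apply: supportedM (hom_ble (@part_hom a d1 P)) (ble_sub_part hQ) => e f h1 h2.
by rewrite wgtD ler_ltD.
Qed.

Lemma lQ0 : (l%:R : rat) != 0. Proof. by rewrite pnatr_eq0 -lt0n. Qed.

Lemma wgt_shiftX a k : wgt a (k.1 + l%:Z, k.2) = wgt a k + a.1.
Proof. by rewrite /wgt /= rmorphD /= -pmulrn; field; rewrite lQ0. Qed.

Lemma wgt_shiftY a k : wgt a (k.1, k.2.+1) = wgt a k + a.2.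
Proof. by rewrite /wgt /= -natr1; ring. Qed.

Lemma ble_dX a d P : ble a d P -> ble a (d - a.1) (dX P).
Proof.
by move=> h e; rewrite coef_dX mulf_eq0 => /norP[_ /h]; rewrite wgt_shiftX -lerBrDr.
Qed.

Lemma ble_dY a d P : ble a d P -> ble a (d - a.2) (dY P).
Proof.
by move=> h e; rewrite coef_dY mulf_eq0 => /norP[_ /h]; rewrite wgt_shiftY -lerBrDr.
Qed.

Lemma part_dX a d P : part a (d - a.1) (dX P) = dX (part a d P).
Proof.
apply: (coef_inj M) => e; rewrite !(coef_part, coef_dX) wgt_shiftX -(inj_eq (addIr a.1))
  subrK.
by case: ifP => //; rewrite mulr0.
Qed.

Lemma part_dY a d P : part a (d - a.2) (dY P) = dY (part a d P).
Proof.
apply: (coef_inj M) => e; rewrite !(coef_part, coef_dY) wgt_shiftY -(inj_eq (addIr a.2))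
  subrK.
by case: ifP => //; rewrite mulr0.
Qed.

(** The derivative in x lowers weights by [a.1], the one in y by [a.2]; both products in the bracket
    thus have the same bound, and [partM] applies to each. *)
Lemma part_brk a d1 d2 P Q : ble a d1 P -> ble a d2 Q ->
  part a (d1 + d2 - (a.1 + a.2)) (brk P Q) = brk (part a d1 P) (part a d2 Q).
Proof.
move=> hP hQ; rewrite /brk partD partN.
have -> : d1 + d2 - (a.1 + a.2) = (d1 - a.1) + (d2 - a.2) by ring.
rewrite partM; [|exact: ble_dX|exact: ble_dY]; rewrite part_dX part_dY.
have -> : d1 - a.1 + (d2 - a.2) = (d2 - a.1) + (d1 - a.2) by ring.
by rewrite partM ?part_dX ?part_dY //; [exact: ble_dX|exact: ble_dY].
Qed.

Lemma ble_brk a d1 d2 P Q : ble a d1 P -> ble a d2 Q ->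
  ble a (d1 + d2 - (a.1 + a.2)) (brk P Q).
Proof.
move=> hP hQ; rewrite /brk; apply: bleD; last apply: bleN.
  have -> : d1 + d2 - (a.1 + a.2) = (d1 - a.1) + (d2 - a.2) by ring.
  by apply: bleM; [exact: ble_dX|exact: ble_dY].
have -> : d1 + d2 - (a.1 + a.2) = (d2 - a.1) + (d1 - a.2) by ring.
by apply: bleM; [exact: ble_dX|exact: ble_dY].
Qed.

Lemma max_exists (T : eqType) (r : seq T) (F : T -> rat) x0 : x0 \in r ->
  exists2 x, x \in r & forall y, y \in r -> F y <= F x.
Proof.
elim: r x0 => // x1 r IH x0 _; case: r IH => [_|x2 r IH].
  by exists x1; rewrite ?mem_head // => y; rewrite inE => /eqP ->.
have [x xr hx] := IH x2 (mem_head _ _); case: (leP (F x1) (F x)) => h.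
  by exists x; [rewrite inE xr orbT|move=> y; rewrite inE => /orP[/eqP -> //|/hx]].
exists x1; rewrite ?mem_head // => y; rewrite inE => /orP[/eqP -> //|/hx hy].
exact: le_trans (ltW h).
Qed.

Lemma deg_exists a P : P != 0 -> exists d, ble a d P /\ part a d P != 0.
Proof.
move=> /(supp0 M)[e0 e0P].
have [|e eP he] := @max_exists _ (supp P) (wgt a) e0; first by rewrite mem_supp.
exists (wgt a e); split; first by move=> f fP; apply: he; rewrite mem_supp.
apply/eqP => /(congr1 (coef^~ e)); rewrite coef_part eqxx coef0 => /eqP.
by apply/negP; rewrite -mem_supp.
Qed.

Lemma deg_uniq a d d' P : ble a d P -> part a d P != 0 ->
  ble a d' P -> part a d' P != 0 -> d = d'.
Proof.
move=> h /(supp0 M)[e]; rewrite coef_part; case: (_ =P d) => [E eP|_]; last by rewrite eqxx.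
move=> h' /(supp0 M)[e']; rewrite coef_part; case: (_ =P d') => [E' eP'|_]; last by
  rewrite eqxx.
by apply/le_anti/andP; split; [rewrite -E; exact: (h' _ eP)|rewrite -E'; exact: (h _ eP')].
Qed.

(** The last weight in increasing order is the maximum; the zero element gets the default value
    0. *)
Definition deg a P : rat :=
  last 0 (sort <=%O [seq wgt a e | e <- supp P]).
Definition ldg a P := part a (deg a P) P.

Lemma deg_spec a P : P != 0 -> ble a (deg a P) P /\ ldg a P != 0.
Proof.
move=> P0; have [d [hd pd]] := deg_exists a P0; suff E : deg a P = d by rewrite /ldg E.
have [e] := supp0 M pd; rewrite coef_part; case: (_ =P d) => [we eP|_]; last by rewrite
  eqxx.
rewrite /deg; set s := sort _ _.
have srt : sorted <=%O s by apply: sort_sorted => x y; exact: le_total.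
have ds : d \in s by rewrite mem_sort; apply/mapP; exists e; rewrite ?mem_supp.
have s0 : (0 < size s)%N by case: (s) ds.
have Ms : last 0 s \in s by rewrite -nth_last mem_nth // prednK.
apply/le_anti/andP; split.
  by move: Ms; rewrite mem_sort => /mapP[f fP ->]; apply: hd; rewrite -mem_supp.
rewrite -nth_last -(nth_index 0 ds).
apply: (sorted_leq_nth le_trans le_refl) => //.
- by rewrite inE index_mem.
- by rewrite inE prednK.
by rewrite -ltnS prednK // index_mem.
Qed.

Lemma degE a d P : ble a d P -> part a d P != 0 -> deg a P = d.
Proof.
move=> h p0; have P0 : P != 0.
  by apply: contraNneq p0 => ->; apply/eqP/(coef_inj M) => e; rewrite coef_part coef0
    if_same.
by have [h1 h2] := deg_spec a P0; apply: (deg_uniq h1 h2).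
Qed.
End Weights.

(** * Leading forms and their extreme exponents *)

Section Vertices.
Context (l : nat) (l0 : (0 < l)%N) (K : fieldType) (ch0 : [pchar K] =i pred0).
Context (L : comAlgType K) (M : laurent_model l L).
Implicit Types (P Q R S F G : L) (e f g : int * nat) (c : K) (a b : rat * rat).
Implicit Types (d : rat).
Local Notation coef := (coef M).
Local Notation mono := (mono M).
Local Notation brk := (brk M).
Local Notation wgt := (wgt l).
Local Notation hom := (hom M).
Local Notation ble := (ble M).
Local Notation part := (part M).
Local Notation deg := (deg M).
Local Notation ldg := (ldg M).

Lemma intr_eq0_pchar (z : int) : (z%:~R == 0 :> K) = (z == 0).
Proof.
have h n : (n%:R == 0 :> K) = (n == 0%N) by move: n; apply/(pcharf0P K).
case: z => n; first by rewrite -pmulrn h.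
by rewrite NegzE mulrNz !oppr_eq0 -pmulrn h.
Qed.

(** Cramer's rule for two independent linear forms. *)
Lemma wgt_inj a b e f : cross a b != 0 ->
  wgt a e = wgt a f -> wgt b e = wgt b f -> e = f.
Proof.
rewrite /cross /wgt => ab h1 h2; have lQ := lQ0 l0.
have X : e.1%:~R / l%:R = f.1%:~R / l%:R :> rat.
  apply: (mulfI ab); transitivity (b.2 * (a.1 * (f.1%:~R / l%:R) + a.2 * f.2%:R)
    - a.2 * (b.1 * (f.1%:~R / l%:R) + b.2 * f.2%:R)); last by ring.
  by rewrite -h1 -h2; ring.
have Y : e.2%:R = f.2%:R :> rat.
  apply: (mulfI ab); transitivity (a.1 * (b.1 * (f.1%:~R / l%:R) + b.2 * f.2%:R)
    - b.1 * (a.1 * (f.1%:~R / l%:R) + a.2 * f.2%:R)); last by ring.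
  by rewrite -h1 -h2; ring.
case: e f X Y {h1 h2} => [e1 e2] [f1 f2] /= X /eqP.
rewrite eqr_nat => /eqP ->; congr pair; apply/eqP.
by rewrite -(eqr_int rat) -(inj_eq (divIf lQ)) X.
Qed.

Lemma deg_hom a d P : P != 0 -> hom a d P -> deg a P = d /\ ldg a P = P.
Proof.
move=> P0 h; have E : deg a P = d by apply: degE; [exact: hom_ble|rewrite hom_part].
by rewrite /ldg E hom_part.
Qed.

Lemma ldg_hom a P : hom a (deg a P) (ldg a P). Proof. exact: part_hom. Qed.

Lemma ldg_neq0 a P : P != 0 -> ldg a P != 0. Proof. by case/(deg_spec M a). Qed.

Lemma deg_ble a P : P != 0 -> ble a (deg a P) P. Proof. by case/(deg_spec M a). Qed.

Lemma hom_part_other a b d d' P : hom a d P -> hom a d (part b d' P).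
Proof.
by move=> h e; rewrite coef_part; case: ifP => _; [apply: h|rewrite eqxx].
Qed.

(** The leading part for a lexicographic order, weight [a] first and then weight [b]; when [a] and
    [b] are independent it is a single term. *)
Definition ld2 a b P := ldg b (ldg a P).

Lemma ld2_mono a b P : cross a b != 0 -> P != 0 ->
  exists c e, c != 0 /\ ld2 a b P = c *: mono e.
Proof.
move=> ab P0; have : ld2 a b P != 0 by do 2!apply: ldg_neq0.
move=> /(supp0 M)[e eP]; exists (coef (ld2 a b P) e), e; split=> //.
apply: (coef_inj M) => f; rewrite coefZ coef_mono.
case: (e =P f) => [<-|ef]; rewrite ?mulr1 ?mulr0 //; apply/eqP.
apply: contra_notT ef => fP.
have h1 g : coef (ld2 a b P) g != 0 -> wgt a g = deg a P.
  by apply: (hom_part_other (@ldg_hom _ _)).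
have h2 g : coef (ld2 a b P) g != 0 -> wgt b g = deg b (ldg a P) by apply: ldg_hom.
by apply: (wgt_inj ab); rewrite (h1, h2) // (h1, h2).
Qed.

(** The lexicographic leading terms are nonzero multiples of monomials, and their product is the
    leading term of the product. *)
Lemma mul_neq0 P Q : P != 0 -> Q != 0 -> P * Q != 0.
Proof.
move=> P0 Q0; pose a : rat * rat := (1, 0); pose b : rat * rat := (0, 1).
have ab : cross a b != 0 by [].
apply/eqP => PQ; have : part b (deg b (ldg a P) + deg b (ldg a Q))
    (part a (deg a P + deg a Q) (P * Q)) = ld2 a b P * ld2 a b Q.
  by rewrite !partM //; apply: deg_ble => //; apply: ldg_neq0.
have [c [e [c0 ->]]] := ld2_mono ab P0; have [c' [e' [c0' ->]]] := ld2_mono ab Q0.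
rewrite PQ !blt_part; try exact: supported0.
rewrite -!(scalerAl, scalerAr) monoM scalerA => /esym/eqP.
by rewrite scaler_eq0 !mulf_eq0 (negbTE c0) (negbTE c0') (negbTE (mono_neq0 _ _)).
Qed.

Lemma exp_neq0 P n : P != 0 -> P ^+ n != 0.
Proof.
move=> P0; elim: n => [|n IH]; first by rewrite expr0 oner_eq0.
by rewrite exprS mul_neq0.
Qed.

Lemma mul_cancel R P Q : R != 0 -> R * P = R * Q -> P = Q.
Proof.
move=> R0 /eqP; rewrite -subr_eq0 -mulrBr => /eqP h; apply/eqP; rewrite -subr_eq0.
by apply: contraTT isT => h'; move: (mul_neq0 R0 h'); rewrite h eqxx.
Qed.

Lemma degM a P Q : P != 0 -> Q != 0 ->
  deg a (P * Q) = deg a P + deg a Q /\ ldg a (P * Q) = ldg a P * ldg a Q.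
Proof.
move=> P0 Q0; have p : part a (deg a P + deg a Q) (P * Q) = ldg a P * ldg a Q.
  by apply: partM; apply: deg_ble.
have E : deg a (P * Q) = deg a P + deg a Q.
  by apply: degE; [apply: bleM; exact: deg_ble|rewrite p mul_neq0 // ldg_neq0].
by rewrite /ldg E.
Qed.

Lemma deg_brk_le a P Q : P != 0 -> Q != 0 -> brk P Q != 0 ->
  deg a (brk P Q) <= deg a P + deg a Q - (a.1 + a.2).
Proof.
move=> P0 Q0 /(deg_spec M a)[_ /(supp0 M)[e]]; rewrite coef_part.
case: (_ =P deg _ _) => [<- |]; last by rewrite eqxx.
by apply: (ble_brk l0 (deg_ble a P0) (deg_ble a Q0)).
Qed.

(** The component of the bracket at the highest weight it can have is the bracket of the leading
    forms; if nonzero, it is the leading form. *)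
Lemma ldg_brk a P Q : P != 0 -> Q != 0 -> brk (ldg a P) (ldg a Q) != 0 ->
  deg a (brk P Q) = deg a P + deg a Q - (a.1 + a.2) /\
  ldg a (brk P Q) = brk (ldg a P) (ldg a Q).
Proof.
move=> P0 Q0; have hP := deg_ble a P0; have hQ := deg_ble a Q0.
rewrite -(part_brk l0 hP hQ) => h.
have E : deg a (brk P Q) = deg a P + deg a Q - (a.1 + a.2).
  by apply: degE => //; apply: ble_brk.
by rewrite /ldg E.
Qed.

(* [vert a b P e]: [e] is the exponent of [P] of greatest [a]-weight, ties being
   broken by [b]. *)
Definition vert a b P e := coef (ld2 a b P) e != 0.

Lemma vert_exists a b P : P != 0 -> exists e, vert a b P e.
Proof. by move=> P0; apply: supp0; do 2!apply: ldg_neq0. Qed.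

Lemma vert_spec a b P e : vert a b P e ->
  [/\ coef P e != 0, wgt a e = deg a P, coef (ldg a P) e != 0
    & wgt b e = deg b (ldg a P)].
Proof.
rewrite /vert /ld2 /(ldg b _) coef_part; case: (_ =P deg b _) => [we|]; last by rewrite
  eqxx.
move=> h; split=> //; first by move: h; rewrite coef_part; case: ifP; rewrite ?eqxx.
exact: ldg_hom h.
Qed.

Lemma vert_neq0 a b P e : vert a b P e -> P != 0.
Proof. by case/vert_spec => + _ _ _; apply: contraNneq => ->; rewrite coef0. Qed.

Lemma vertP a b P e : P != 0 ->
  (vert a b P e <-> coef P e != 0 /\ forall f, coef P f != 0 ->
     wgt a f <= wgt a e /\ (wgt a f = wgt a e -> wgt b f <= wgt b e)).
Proof.
move=> P0; have hP := deg_ble a P0; have lP := ldg_neq0 a P0; split.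
  case/vert_spec => h1 h2 h3 h4; split=> // f fP; split; first by rewrite h2; exact: (hP
    f fP).
  rewrite h2 h4 => h5; apply: (deg_ble b lP); by rewrite coef_part h5 eqxx.
move=> [eP h]; have we : wgt a e = deg a P.
  apply/le_anti/andP; split; first exact: (hP e eP).
  have [f] := supp0 M lP; rewrite coef_part; case: (_ =P deg a P) => [<- /h[] //|].
  by rewrite eqxx.
have eL : coef (ldg a P) e != 0 by rewrite coef_part we eqxx.
rewrite /vert /ld2 coef_part; case: ifP => // /negP[]; apply/eqP/le_anti/andP; split.
  exact: (deg_ble b lP).
have [f] := supp0 M (ldg_neq0 b lP); rewrite coef_part.
case: (_ =P deg b _) => [<-|]; last by rewrite eqxx.
rewrite coef_part; case: (_ =P deg a P) => [wf fP|]; last by rewrite eqxx.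
by have [_] := h f fP; apply; rewrite we.
Qed.

Lemma vert_uniq a b P e f : cross a b != 0 -> vert a b P e -> vert a b P f -> e = f.
Proof.
move=> ab /vert_spec[_ h1 _ h2] /vert_spec[_ h3 _ h4].
by apply: (wgt_inj ab); rewrite ?h1 ?h2 ?h3 ?h4.
Qed.

Lemma ld2_vert a b P e : cross a b != 0 -> vert a b P e ->
  exists2 c, c != 0 & ld2 a b P = c *: mono e.
Proof.
move=> ab ve; have [c [f [c0 E]]] := ld2_mono ab (vert_neq0 ve); exists c => //.
suff -> : e = f by [].
by apply: (vert_uniq ab ve); rewrite /vert E coefZ coef_mono eqxx mulr1.
Qed.

Lemma vertM a b P Q e f : cross a b != 0 -> vert a b P e -> vert a b Q f ->
  vert a b (P * Q) (e.1 + f.1, (e.2 + f.2)%N).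
Proof.
move=> ab ve vf; have P0 := vert_neq0 ve; have Q0 := vert_neq0 vf.
rewrite /vert /ld2 (degM a P0 Q0).2 (degM b (ldg_neq0 a P0) (ldg_neq0 a Q0)).2.
rewrite -!/(ld2 _ _ _); have [c c0 ->] := ld2_vert ab ve; have [c' c0' ->] := ld2_vert ab
  vf.
by rewrite -!(scalerAl, scalerAr) monoM !coefZ coef_mono eqxx mulr1 mulf_neq0.
Qed.

Lemma vert_ldg a b P e : vert a b (ldg a P) e <-> vert a b P e.
Proof.
have [->|P0] := eqVneq P 0.
  by split => /vert_neq0; rewrite /ldg ?blt_part ?eqxx //; exact: supported0.
by rewrite /vert /ld2 (deg_hom (ldg_neq0 a P0) (@ldg_hom a P)).2.
Qed.

(** The top term of the bracket of the leading forms comes from the two extreme monomials, and its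
    scalar is the determinant of their exponents. Its vanishing gives [brk0_cross], its
    non-vanishing [brk_vert]. *)
Lemma part_ld2_brk a b P Q e f : cross a b != 0 -> vert a b P e -> vert a b Q f ->
  exists2 c, c != 0 & exists d,
    part b d (brk (ldg a P) (ldg a Q)) =
      (c * (e.1 * f.2%:Z - f.1 * e.2%:Z)%:~R) *: mono (e.1 + f.1 - l%:Z, (e.2 + f.2).-1)
    /\ ble b d (brk (ldg a P) (ldg a Q)).
Proof.
move=> ab ve vf; have P0 := vert_neq0 ve; have Q0 := vert_neq0 vf.
have [c c0 Ec] := ld2_vert ab ve; have [c' c0' Ec'] := ld2_vert ab vf.
have hP := deg_ble b (ldg_neq0 a P0); have hQ := deg_ble b (ldg_neq0 a Q0).
exists (c * c' / l%:R).
  rewrite !mulf_neq0 ?invr_neq0 //.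
  by have := intr_eq0_pchar l%:Z; rewrite -pmulrn => ->; rewrite -lt0n.
exists (deg b (ldg a P) + deg b (ldg a Q) - (b.1 + b.2)).
split; last exact: ble_brk.
rewrite (part_brk l0 hP hQ) -!/(ldg _ _) -!/(ld2 _ _ _) Ec Ec' brkZl brkZr brk_mono
  !scalerA.
congr (_ *: _); rewrite rmorphB !rmorphM /= -!pmulrn; ring.
Qed.

(** In characteristic zero the determinant vanishes as an integer: vertices of commuting leading
    forms are collinear with the origin. *)
Lemma brk0_cross a b P Q e f : cross a b != 0 -> vert a b P e -> vert a b Q f ->
  brk (ldg a P) (ldg a Q) = 0 -> e.1 * f.2%:Z = f.1 * e.2%:Z.
Proof.
move=> ab ve vf b0; have [c c0 [d [+ _]]] := part_ld2_brk ab ve vf.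
rewrite b0 blt_part; last exact: supported0.
move=> /esym/eqP; rewrite scaler_eq0 (negbTE (mono_neq0 _ _)) orbF mulf_eq0 (negbTE c0).
by rewrite intr_eq0_pchar subr_eq0 => /eqP.
Qed.

Lemma brk_vert a b P Q e f : cross a b != 0 -> vert a b P e -> vert a b Q f ->
  e.1 * f.2%:Z != f.1 * e.2%:Z ->
  vert a b (brk (ldg a P) (ldg a Q)) (e.1 + f.1 - l%:Z, (e.2 + f.2).-1).
Proof.
move=> ab ve vf ef; have [c c0 [d [h1 h2]]] := part_ld2_brk ab ve vf.
set X := brk _ _ in h1 h2 *.
have k0 : c * (e.1 * f.2%:Z - f.1 * e.2%:Z)%:~R != 0.
  by rewrite mulf_neq0 // intr_eq0_pchar subr_eq0.
have p0 : part b d X != 0.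
  by rewrite h1 scaler_eq0 (negbTE k0) (negbTE (mono_neq0 _ _)).
have P0 := vert_neq0 ve; have Q0 := vert_neq0 vf.
have X0 : X != 0.
  by apply: contraNneq p0 => ->; rewrite blt_part //; exact: supported0.
have hX : hom a (deg a P + deg a Q - (a.1 + a.2)) X.
  have := @part_hom _ _ _ M a (deg a P + deg a Q - (a.1 + a.2)) (brk P Q).
  by rewrite (part_brk l0 (deg_ble a P0) (deg_ble a Q0)).
rewrite /vert /ld2 (deg_hom X0 hX).2 /ldg (degE h2 p0) h1 coefZ coef_mono eqxx mulr1.
exact: k0.
Qed.
End Vertices.

(** * Propagation of proportionality along directions *)

Section Propagation.
Context (l : nat) (l0 : (0 < l)%N) (K : fieldType) (ch0 : [pchar K] =i pred0).
Context (L : comAlgType K) (M : laurent_model l L).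
Implicit Types (P Q R S F G X : L) (e f g : int * nat) (a b u w : rat * rat).
Implicit Types (s t k j d : rat).
Local Notation coef := (coef M).
Local Notation brk := (brk M).
Local Notation wgt := (wgt l).
Local Notation deg := (deg M).
Local Notation ldg := (ldg M).
Local Notation vert := (vert M).
Local Notation supp := (supp M).

Definition seg (w0 w1 : rat * rat) (s : rat) : rat * rat :=
  ((1 - s) * w0.1 + s * w1.1, (1 - s) * w0.2 + s * w1.2).

Lemma seg0 w0 w1 : seg w0 w1 0 = w0.
Proof. by case: w0 => x y; congr pair => /=; ring. Qed.

Lemma seg1 w0 w1 : seg w0 w1 1 = w1.
Proof. by case: w1 => x y; congr pair => /=; ring. Qed.

Lemma wgt_seg w0 w1 s e : wgt (seg w0 w1 s) e = (1 - s) * wgt w0 e + s * wgt w1 e.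
Proof. exact: wgt_lin. Qed.

Lemma cross_seg w0 w1 s : cross (seg w0 w1 s) w1 = - ((1 - s) * cross w1 w0).
Proof. by rewrite /cross /seg /=; ring. Qed.

Lemma deg_vert a b P e : vert a b P e -> wgt a e = deg a P.
Proof. by case/vert_spec. Qed.

(* The parameters at which two exponents of [X] have equal weight along the
   segment; between two consecutive ones the degree of [X] is affine. *)
Definition breaks w0 w1 X : seq rat :=
  [seq (wgt w0 e - wgt w0 f) /
       (wgt w0 e - wgt w0 f - (wgt w1 e - wgt w1 f)) | e <- supp X, f <- supp X].

(** An exponent heavier than [e] at [s] but not before it at [s'] would tie with [e] at a breakpoint
    strictly in between, unless they tie at [s'] itself; that case is settled by breaking ties
    towards [w1]. *)
Lemma vert_seg w0 w1 X e s s' :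
  vert (seg w0 w1 s') w1 X e -> s' < s -> s <= 1 ->
  (forall t, t \in breaks w0 w1 X -> t < s -> t <= s') ->
  wgt (seg w0 w1 s) e = deg (seg w0 w1 s) X.
Proof.
move=> ve ss s1 gap; have X0 := vert_neq0 ve; have [eX he] := (vertP M _ _ e X0).1 ve.
suff h f : coef X f != 0 -> wgt (seg w0 w1 s) f <= wgt (seg w0 w1 s) e.
  apply/esym/degE => // ; apply/eqP => /(congr1 (coef^~ e)).
  by rewrite coef_part eqxx coef0 => /eqP; apply/negP.
move=> fX; rewrite leNgt; apply/negP => hlt.
have [] := he f fX; have : (wgt w0 f - wgt w0 e) /
   (wgt w0 f - wgt w0 e - (wgt w1 f - wgt w1 e)) \in breaks w0 w1 X.
  by apply/allpairsP; exists (f, e); rewrite !mem_supp.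
move: hlt; rewrite !wgt_seg => {he fX eX}.
move: (wgt w0 f) (wgt w1 f) (wgt w0 e) (wgt w1 e) => f0 f1 e0 e1.
set D0 := f0 - e0; set D1 := f1 - e1 => hs tB hs'.
have {}hs : 0 < (1 - s) * D0 + s * D1 by rewrite /D0 /D1; lra.
have hs'' : (1 - s') * D0 + s' * D1 <= 0 by rewrite /D0 /D1; lra.
have DD : 0 < D1 - D0.
  rewrite -(pmulr_rgt0 _ (_ : 0 < s - s')) ?subr_gt0 //.
  have -> : (s - s') * (D1 - D0) =
    ((1 - s) * D0 + s * D1) - ((1 - s') * D0 + s' * D1) by ring.
  lra.
(* A tie at [s']: the tie-break gives [D1 <= 0], and the weight difference, being affine and 0 at
   [s'], cannot be positive at [s]. *)
have [E|ne] := eqVneq ((1 - s') * D0 + s' * D1) 0.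
  have h : (1 - s') * f0 + s' * f1 = (1 - s') * e0 + s' * e1.
    by move: E; rewrite /D0 /D1; lra.
  move=> /(_ h) ef; have D1le : D1 <= 0 by rewrite /D1; lra.
  have: (1 - s') * ((1 - s) * D0 + s * D1) = (s - s') * D1.
    transitivity ((1 - s) * ((1 - s') * D0 + s' * D1) + (s - s') * D1); first by ring.
    by rewrite E mulr0 add0r.
  nra.
move=> _; have lt' : (1 - s') * D0 + s' * D1 < 0 by rewrite lt_neqAle ne.
(* [t] is the zero of the weight difference, which is negative at [s'] and positive at [s]. *)
have := gap _ tB; set t := D0 / _.
have tE : t * (D1 - D0) = - D0.
  by rewrite /t; field; lra.
have lts : t < s by rewrite -(ltr_pM2r DD) tE; lra.
move=> /(_ lts); rewrite -(ler_pM2r DD) tE; lra.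
Qed.

Section Aligned.
Context (k : rat) (P : L).

(** The ratio [j / k] of the degrees is kept as two factors: in the application [k] is the
    y-exponent of the vertex of [P] and [j] that of the vertex of [G]. *)
Definition eqdeg j G w := k * deg w G = j * deg w P.

(* In every direction slightly clockwise from [w] the leading exponents of [P]
   and [G] are proportional, with ratio [j / k]. *)
Definition aligned j G w := forall b e g, cross w b < 0 ->
  vert w b P e -> vert w b G g -> forall a, k * wgt a g = j * wgt a e.

(** Induction on the number of breakpoints passed. From one breakpoint to the next both degrees are
    the weights of fixed vertices, which alignment makes proportional. *)
Lemma eqdeg_segment j G w0 w1 : P != 0 -> G != 0 -> 0 < cross w1 w0 ->
  (forall s, 0 <= s < 1 -> eqdeg j G (seg w0 w1 s) -> aligned j G (seg w0 w1 s)) ->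
  eqdeg j G w0 -> eqdeg j G w1.
Proof.
(* The starting parameter 0 is added so that every positive [s] has a last breakpoint [s'] before
   it. *)
move=> P0 G0 cr hal h0; pose B := 0 :: breaks w0 w1 P ++ breaks w0 w1 G.
suff H n s : (count (fun t => (t < s)%R) B <= n)%N -> 0 <= s <= 1 ->
    eqdeg j G (seg w0 w1 s).
  by rewrite -(seg1 w0 w1); apply: H; rewrite ?lexx ?ler01.
elim: n s => [|n IH] s.
  rewrite leqn0 => /eqP cnt /andP[s0 s1]; have [->|sn0] := eqVneq s 0; first by rewrite
    seg0.
  by move: cnt; rewrite /= lt_neqAle eq_sym sn0 s0.
move=> cnt /andP[s0 s1]; have [->|sn0] := eqVneq s 0; first by rewrite seg0.
have s_gt0 : 0 < s by rewrite lt_neqAle eq_sym sn0.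
have [|s' s'B gap] := @max_exists _ [seq t <- B | t < s] id 0.
  by rewrite mem_filter s_gt0 mem_head.
move: s'B; rewrite mem_filter => /andP[ss s'B].
have {}gap t : t \in B -> t < s -> t <= s' by move=> tB ts; apply: gap; rewrite
  mem_filter ts.
have s'0 : 0 <= s' by apply: gap; rewrite ?mem_head.
have s'1 : s' < 1 by apply: lt_le_trans ss s1.
have e' : eqdeg j G (seg w0 w1 s').
  apply: IH; last by rewrite s'0 ltW.
  rewrite -ltnS; apply: leq_trans cnt.
  have := count_predUI (fun t => (t < s')%R) (pred1 s') B.
  rewrite (@eq_count _ (predI _ _) pred0) ?count_pred0 ?addn0; last first.
    by move=> t /=; case: eqP => [->|]; rewrite ?ltxx ?andbF.
  move=> E; apply: (@leq_trans (count (predU (fun t => (t < s')%R) (pred1 s')) B)).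
    by rewrite E -addn1 leq_add2l -has_count has_pred1.
  by apply: sub_count => t /= /orP[h|/eqP -> //]; exact: lt_trans ss.
have a' := hal s' (introT andP (conj s'0 s'1)) e'.
have [e ve] := vert_exists M (seg w0 w1 s') w1 P0.
have [g vg] := vert_exists M (seg w0 w1 s') w1 G0.
have cr' : cross (seg w0 w1 s') w1 < 0 by rewrite cross_seg oppr_lt0 mulr_gt0 // subr_gt0.
have := a' _ _ _ cr' ve vg (seg w0 w1 s).
rewrite (vert_seg ve ss s1) ?(vert_seg vg ss s1) // => t tB; apply: gap;
  by rewrite inE mem_cat tB ?orbT.
Qed.

Lemma cross_perp w : w != 0 -> cross w (w.2, - w.1) < 0.
Proof.
case: w => x y; rewrite /cross /= -[_ == _]/((x, y) == (0, 0)) xpair_eqE.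
move=> h; have -> : x * - x - y * y = - (x * x + y * y) by ring.
rewrite oppr_lt0 -!expr2 lt_neqAle eq_sym paddr_eq0 ?sqr_ge0 // !sqrf_eq0 h.
by rewrite addr_ge0 ?sqr_ge0.
Qed.

Lemma deg_pos_neq0 w : 0 < deg w P -> P != 0 -> w != 0.
Proof.
move=> d0 P0; apply: contraTneq d0 => ->; have [e /deg_vert <-] := vert_exists M 0 0 P0.
by rewrite /wgt /= !mul0r addr0 ltxx.
Qed.

Lemma aligned_eqdeg j G w : P != 0 -> G != 0 -> w != 0 -> aligned j G w -> eqdeg j G w.
Proof.
move=> P0 G0 wn0 al; have [e ve] := vert_exists M w (w.2, - w.1) P0.
have [g vg] := vert_exists M w (w.2, - w.1) G0.
by rewrite /eqdeg -(deg_vert ve) -(deg_vert vg); apply: al vg _ => //; apply: cross_perp.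
Qed.

(** Commutation puts the two vertices on one line through the origin; comparing their weights at
    [w], where that of [P] is nonzero, fixes the ratio. *)
Lemma brk0_aligned j G w : 0 < deg w P -> eqdeg j G w ->
  brk (ldg w G) (ldg w P) = 0 -> aligned j G w.
Proof.
move=> d0 ed b0 b e g /lt_eqF/negbT cr ve vg a.
have := brk0_cross l0 ch0 cr vg ve b0; move: d0 ed.
rewrite /eqdeg -(deg_vert ve) -(deg_vert vg) => d0 ed /(congr1 (fun z : int => z%:~R /
  l%:R : rat)).
rewrite !rmorphM /= -!pmulrn => cr0.
have {}cr0 : g.1%:~R / l%:R * e.2%:R = e.1%:~R / l%:R * g.2%:R :> rat.
  by rewrite mulrAC cr0 mulrAC.
move: d0 ed cr0; rewrite /wgt.
move: (g.1%:~R / l%:R) (e.1%:~R / l%:R) (g.2%:R : rat) (e.2%:R : rat) => x1 x2 y1 y2 d0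
  ed cr0.
(* Multiplied by the degree of [P], each coordinate of the defect is a combination of the degree
   equation and the determinant. *)
have X : k * x1 - j * x2 = 0.
  apply/eqP; rewrite -(mulrI_eq0 _ (lregP (lt0r_neq0 d0))).
  have -> : (w.1 * x2 + w.2 * y2) * (k * x1 - j * x2) =
     x2 * (k * (w.1 * x1 + w.2 * y1) - j * (w.1 * x2 + w.2 * y2)) + w.2 * k * (x1 * y2 -
       x2 * y1) by ring.
  by rewrite ed cr0 !subrr !mulr0 addr0.
have Y : k * y1 - j * y2 = 0.
  apply/eqP; rewrite -(mulrI_eq0 _ (lregP (lt0r_neq0 d0))).
  have -> : (w.1 * x2 + w.2 * y2) * (k * y1 - j * y2) =
     y2 * (k * (w.1 * x1 + w.2 * y1) - j * (w.1 * x2 + w.2 * y2)) - w.1 * k * (x1 * y2 -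
       x2 * y1) by ring.
  by rewrite ed cr0 !subrr !mulr0 subr0.
apply/eqP; rewrite -subr_eq0.
have -> : k * (a.1 * x1 + a.2 * y1) - j * (a.1 * x2 + a.2 * y2) =
   a.1 * (k * x1 - j * x2) + a.2 * (k * y1 - j * y2) by ring.
by rewrite X Y !mulr0 addr0.
Qed.

Section Reach.
Context (Z : rat * rat -> Prop) (u : rat * rat).

(** Polygonal paths turning clockwise by less than a half turn at each step, with [Z] required along
    each segment except at its start: the condition [inner] used later can fail at [u] itself, where
    the cross product is 0. Several steps allow arcs beyond a half turn. *)
Inductive reach : rat * rat -> Prop :=
| reach_start : reach u
| reach_seg w0 w1 : reach w0 -> 0 < cross w1 w0 ->
    (forall s, 0 < s <= 1 -> Z (seg w0 w1 s)) -> reach w1.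

Lemma reach_between w0 w1 s : reach w0 -> 0 < cross w1 w0 ->
  (forall s, 0 < s <= 1 -> Z (seg w0 w1 s)) -> 0 < s <= 1 -> reach (seg w0 w1 s).
Proof.
move=> r0 cr hZ /andP[s0 s1]; apply: (reach_seg r0).
  have -> : cross (seg w0 w1 s) w0 = s * cross w1 w0 by rewrite /cross /seg /=; ring.
  by rewrite mulr_gt0.
move=> t /andP[t0 t1]; have -> : seg w0 (seg w0 w1 s) t = seg w0 w1 (t * s).
  by rewrite /seg /=; congr pair; ring.
apply: hZ; rewrite mulr_gt0 //=; nra.
Qed.

(** Along each segment [eqdeg_segment] carries equality of degrees forward, and the hypothesis turns
    equality back into alignment. *)
Lemma reach_aligned j G : P != 0 -> G != 0 -> (forall w, reach w -> w != 0) ->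
  aligned j G u ->
  (forall w, reach w -> Z w -> eqdeg j G w -> aligned j G w) ->
  forall w, reach w -> aligned j G w.
Proof.
move=> P0 G0 rn0 hu hZ w; elim=> // w0 w1 r0 IH cr hseg.
have r1 : reach w1 by apply: reach_seg hseg.
apply: (hZ) => //; first by rewrite -(seg1 w0 w1); apply: (hseg); rewrite ltr01 lexx.
apply: (eqdeg_segment P0 G0 cr); last by apply: aligned_eqdeg => //; apply: rn0.
move=> s /andP[s0 s1]; have [->|sn0] := eqVneq s 0; first by rewrite seg0.
have s01 : 0 < s <= 1 by rewrite lt_neqAle eq_sym sn0 s0 ltW.
by apply: hZ; [exact: reach_between|exact: hseg].
Qed.
End Reach.

(* Lagrange's identity makes the ratio of the weights of [e] and (1, 1) increase
   clockwise, [e] being below the diagonal. *)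
Lemma diag_below (u w : rat * rat) (x y d D : rat) :
  y < x -> 0 < u.1 * x + u.2 * y -> 0 <= u.1 + u.2 ->
  u.1 + u.2 <= d * (u.1 * x + u.2 * y) ->
  0 < D -> w.1 * x + w.2 * y <= D ->
  (0 <= w.1 + w.2 -> 0 < u.1 + u.2 /\ 0 < cross w u) ->
  w.1 + w.2 < d * D.
Proof.
move=> yx ux uC dC D0 wD hw.
have d0 : 0 <= d.
  rewrite leNgt; apply/negP => dn; suff: d * (u.1 * x + u.2 * y) < 0 by lra.
  by rewrite nmulr_rlt0.
have dD : 0 <= d * D by rewrite mulr_ge0 // ltW.
have [wC|wC0] := ltP (w.1 + w.2) 0; first exact: lt_le_trans dD.
have [uC0 wu] := hw wC0.
have dp : 0 < d.
  rewrite lt_neqAle d0 andbT eq_sym; apply: contraTneq uC0 => d00.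
  by rewrite d00 mul0r in dC; rewrite -leNgt.
apply: (@lt_le_trans _ _ (d * (w.1 * x + w.2 * y))); last by rewrite ler_pM2l.
have lagrange : (w.1 * x + w.2 * y) * (u.1 + u.2) =
  (u.1 * x + u.2 * y) * (w.1 + w.2) + cross w u * (x - y) by rewrite /cross; ring.
have pos : 0 < cross w u * (x - y) by rewrite mulr_gt0 // subr_gt0.
have [wC|wC] := ltP 0 (w.1 + w.2); last first.
  have wx : 0 < (w.1 * x + w.2 * y) * (u.1 + u.2).
    have E : w.1 + w.2 = 0 by lra.
    by rewrite lagrange E mulr0 add0r.
  have : 0 < w.1 * x + w.2 * y by rewrite pmulr_lgt0 in wx.
  by move=> h; apply: le_lt_trans wC _; rewrite mulr_gt0.
rewrite -(ltr_pM2r uC0) -[d * _ * _]mulrA lagrange [d * (_ + _)]mulrDr [d * (_ * _)]mulrA.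
have h1 : (u.1 + u.2) * (w.1 + w.2) <= d * (u.1 * x + u.2 * y) * (w.1 + w.2).
  by rewrite ler_pM2r.
have h2 : 0 < d * (cross w u * (x - y)) by rewrite mulr_gt0.
rewrite [X in X < _]mulrC; lra.
Qed.

Section Chain.
Context (u : rat * rat) (e0 : int * nat).
Hypotheses (k0 : 0 < k) (P0 : P != 0) (du : deg u P = wgt u e0) (du0 : 0 < deg u P)
  (e0P : coef P e0 != 0) (e0b : e0.2%:R < e0.1%:~R / l%:R :> rat) (uC : 0 <= u.1 + u.2).

(** The second condition feeds [diag_below]. It places [w] clockwise of [u] by less than a half
    turn, but only while w.(1, 1) is nonnegative; past that point the inequality sought is
    immediate. *)
Definition inner w :=
  0 < deg w P /\ (0 <= w.1 + w.2 -> 0 < u.1 + u.2 /\ 0 < cross w u).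

Lemma reach_pos w : reach inner u w -> 0 < deg w P.
Proof.
case=> // w0 w1 _ _ /(_ 1); rewrite seg1 => h; apply: (h _).1.
by rewrite ltr01 lexx.
Qed.

Lemma reach_neq0 w : reach inner u w -> w != 0.
Proof. by move/reach_pos/deg_pos_neq0; apply. Qed.

(** If the leading forms did not commute at [w], the degree bound for [G, P] would be an equality
    there, while at [u] it is still an inequality. With the degrees of [G] and [G, P] proportional
    to that of [P] at both places, [diag_below] is contradicted. *)
Lemma chain_brk0 j j' G w : G != 0 ->
  (brk G P != 0 -> forall w, reach inner u w -> eqdeg j' (brk G P) w) ->
  eqdeg j G u -> reach inner u w -> inner w -> eqdeg j G w ->
  brk (ldg w G) (ldg w P) = 0.
Proof.
move=> G0 hG' eu rw [dw wC] ew; apply/eqP/negPn/negP => nb.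
have [degG' ldgG'] := ldg_brk l0 G0 P0 nb.
have G'0 : brk G P != 0.
  apply: contraNneq nb => G'0; rewrite -ldgG' G'0.
  by rewrite /ldg blt_part //; exact: supported0.
have := hG' G'0 w rw; have := hG' G'0 u (reach_start _ _).
have := deg_brk_le l0 u G0 P0 G'0.
move: eu ew; rewrite /eqdeg degG' => eu ew leu e1 e2.
(* Solving deg [G, P] = deg G + deg P - w.(1, 1) at [w], in units of deg P, gives w.(1, 1) = d deg
   P. *)
pose d := (j + k - j') / k.
have dk : d * k = j + k - j' by rewrite /d divfK // lt0r_neq0.
have dwC : w.1 + w.2 = d * deg w P.
  apply: (mulIf (lt0r_neq0 k0)); rewrite mulrAC dk; lra.
suff: w.1 + w.2 < d * deg w P by rewrite dwC ltxx.
apply: (@diag_below u w (e0.1%:~R / l%:R) e0.2%:R) => //.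
- by rewrite -/(wgt u e0) -du.
- rewrite -/(wgt u e0) -du -(ler_pM2r k0) mulrAC dk.
  have := ler_wpM2l (ltW k0) leu; rewrite e1; lra.
exact: (deg_ble w P0 e0P).
Qed.

Lemma chain_aligned j j' G : G != 0 ->
  (brk G P != 0 -> forall w, reach inner u w -> eqdeg j' (brk G P) w) ->
  aligned j G u -> forall w, reach inner u w -> aligned j G w.
Proof.
move=> G0 hG' au w; apply: reach_aligned => //; first exact: reach_neq0.
move=> w' rw iw ew; apply: brk0_aligned => //; first exact: reach_pos.
apply: chain_brk0 hG' _ rw iw ew => //.
by apply: aligned_eqdeg => //; apply: reach_neq0; apply: reach_start.
Qed.
End Chain.
End Aligned.
End Propagation.

(** * Commuting homogeneous elements *)

Section HomogeneousRoots.
Context (l : nat) (l0 : (0 < l)%N) (K : fieldType) (ch0 : [pchar K] =i pred0).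
Context (L : comAlgType K) (M : laurent_model l L).
Implicit Types (P Q R S X Y Z N D : L) (e f g : int * nat) (c : K) (d : rat).
Local Notation coef := (coef M).
Local Notation mono := (mono M).
Local Notation dX := (dX M).
Local Notation dY := (dY M).
Local Notation brk := (brk M).
Local Notation wgt := (wgt l).
Local Notation hom := (hom M).
Local Notation part := (part M).

(** The monomial with exponent [(l, 0)] is x. Unlike the derivatives, the operators x d/dx and y
    d/dy are diagonal on monomials. *)
Lemma coef_xdX P e : coef (mono (l%:Z, 0%N) * dX P) e = e.1%:~R / l%:R * coef P e.
Proof.
elim/(@model_ind _ _ _ M): P => [|c f P IH]; first by rewrite dX0 mulr0 !coef0 mulr0.
rewrite dXD mulrDr !coefD mulrDr IH dXZ dX_mono; congr (_ + _).
rewrite -!scalerAr !coefZ monoM /= add0n addrC subrK -surjective_pairing coef_mono.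
by case: (f =P e) => [->|_]; rewrite ?mulr0 // !mulr1 mulrC.
Qed.

Lemma coef_ydY P e : coef (mono (0, 1%N) * dY P) e = e.2%:R * coef P e.
Proof.
elim/(@model_ind _ _ _ M): P => [|c f P IH]; first by rewrite dY0 mulr0 !coef0 mulr0.
rewrite dYD mulrDr !coefD mulrDr IH dYZ dY_mono; congr (_ + _).
rewrite -!scalerAr !coefZ monoM /= add0r add1n.
case: f => f1 [|f2] /=; rewrite !coef_mono.
  by rewrite mul0r mulr0; case: eqP => [<- /=|_]; rewrite ?mul0r ?mulr0.
by case: eqP => [<-|_]; rewrite ?mulr0 // !mulr1 mulrC.
Qed.

Section Direction.
Context (u : int * int) (u0 : u != 0).
Definition dirQ : rat * rat := (u.1%:~R, u.2%:~R).

(** The weight multiplied by [l]: an integer, so that it has an image in [K]. *)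
Definition izw e : int := u.1 * e.1 + l%:Z * u.2 * e.2%:Z.

Lemma izwE e : (izw e)%:~R = l%:R * wgt dirQ e.
Proof.
rewrite /izw /wgt rmorphD !rmorphM /= -!pmulrn; field; exact: lQ0.
Qed.

(** Euler's identity for homogeneous elements, multiplied by [l] to make its scalars images of
    integers. *)
Lemma euler d P : hom dirQ d P -> P != 0 -> exists2 z : int, z%:~R = l%:R * d &
  (l%:Z * u.1)%:~R *: (mono (l%:Z, 0%N) * dX P) + (l%:Z * u.2)%:~R *: (mono (0, 1%N) * dY P)
  = z%:~R *: P.
Proof.
move=> hP /(supp0 M)[e0 e0P]; exists (izw e0); first by rewrite izwE (hP _ e0P).
apply: (coef_inj M) => e; rewrite coefD !coefZ coef_xdX coef_ydY.
have [->|eP] := eqVneq (coef P e) 0; first by rewrite !mulr0 addr0.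
have -> : izw e0 = izw e.
  by apply/eqP; rewrite -(eqr_int rat) !izwE (hP _ e0P) (hP _ eP).
rewrite /izw rmorphD !rmorphM /= -!pmulrn; field.
by have := intr_eq0_pchar ch0 l%:Z; rewrite -pmulrn => ->; rewrite -lt0n.
Qed.

(** A three-term identity shows that both partial derivatives of [S] times [X, Y] vanish; Euler's
    identity, with [d] nonzero, gives S [X, Y] = 0. *)
Lemma brk_trans d S X Y : hom dirQ d S -> S != 0 -> d != 0 ->
  brk X S = 0 -> brk Y S = 0 -> brk X Y = 0.
Proof.
move=> hS S0 d0 XS YS; have [z zE E] := euler hS S0.
have zK : z%:~R != 0 :> K.
  by rewrite intr_eq0_pchar // -(intr_eq0 rat) zE mulf_neq0 // lQ0.
apply/eqP/negPn/negP => /(mul_neq0 l0 M) h.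
suff : S * brk X Y = 0 by move=> /eqP; apply/negP; rewrite mulrC h.
have hx : dX S * brk X Y = 0.
  have -> : dX S * brk X Y = dX Y * brk X S - dX X * brk Y S by rewrite /brk; ring.
  by rewrite XS YS !mulr0 subrr.
have hy : dY S * brk X Y = 0.
  have -> : dY S * brk X Y = dY Y * brk X S - dY X * brk Y S by rewrite /brk; ring.
  by rewrite XS YS !mulr0 subrr.
have : (z%:~R *: S) * brk X Y = 0.
  by rewrite -E mulrDl -!scalerAl -!mulrA hx hy !mulr0 !scaler0 addr0.
by move/eqP; rewrite -scalerAl scaler_eq0 (negbTE zK) => /eqP.
Qed.

(** [X], [Y] and every nonzero combination of them have the same logarithmic derivatives, hence the
    same lexicographic leading exponent; a combination without that term must be 0. *)
Lemma log_derivative_prop X Y : X != 0 -> Y != 0 ->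
  X * dX Y = Y * dX X -> X * dY Y = Y * dY X -> exists2 c, c != 0 & X = c *: Y.
Proof.
move=> X0 Y0 hx hy; pose a : rat * rat := (1, 0); pose b : rat * rat := (0, 1).
have ab : cross a b != 0 by [].
have [e ve] := vert_exists M a b Y0.
have eY : coef Y e != 0 by case/vert_spec: ve.
(* [c] is chosen to cancel the term at the vertex [e] of [Y]. *)
pose c := coef X e / coef Y e; pose Z := X - c *: Y.
have [Z0|Z0] := eqVneq Z 0.
  have XE : X = c *: Y by apply/eqP; rewrite -subr_eq0 -/Z Z0.
  by exists c => //; apply: contraNneq X0 => c0; rewrite XE c0 scale0r.
have [f vf] := vert_exists M a b Z0.
have Ze : coef Z e = 0 by rewrite coefB coefZ divfK // subrr.
(* For an operator with monomial eigenvalues [F], comparing leading terms in Z th(Y) = Y th(Z)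
   equates the eigenvalues at the two vertices. *)
have key (th : L -> L) (F : int * nat -> K) : (forall P k, coef (th P) k = F k * coef P
  k) ->
    Z * th Y = Y * th Z -> F e = F f.
  move=> thE hZ.
  have hpart a' d P : part a' d (th P) = th (part a' d P).
    by apply: (coef_inj M) => k; rewrite !(coef_part, thE); case: ifP; rewrite ?mulr0.
  have hble a' d P : ble M a' d P -> ble M a' d (th P).
    by move=> hb k; rewrite thE mulf_eq0 => /norP[_ /hb].
  have thmono g c' : th (c' *: mono g) = (F g * c') *: mono g.
    apply: (coef_inj M) => k; rewrite thE !coefZ coef_mono.
    by case: (g =P k) => [->|_]; rewrite ?mulr0 ?mulr1.
  have two P Q : P != 0 -> Q != 0 ->
      part b (deg M b (ldg M a P) + deg M b (ldg M a Q))
        (part a (deg M a P + deg M a Q) (P * th Q)) = ld2 M a b P * th (ld2 M a b Q).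
    move=> P0 Q0; rewrite partM; [|exact: deg_ble|by apply: hble; exact: deg_ble].
    rewrite hpart partM ?hpart //; first by apply: deg_ble; apply: ldg_neq0.
    by apply: hble; apply: deg_ble; apply: ldg_neq0.
  have := two _ _ Z0 Y0; rewrite hZ addrC [deg M a Z + _]addrC two //.
  have [c1 c10 ->] := ld2_vert l0 ab ve; have [c2 c20 ->] := ld2_vert l0 ab vf.
  rewrite !thmono -!(scalerAl, scalerAr) !monoM !scalerA /=.
  move=> /(congr1 (fun P => coef P (e.1 + f.1, (e.2 + f.2)%N))).
  rewrite !coefZ !coef_mono eqxx [f.1 + _]addrC [(f.2 + _)%N]addnC eqxx !mulr1.
  move=> E; apply: (mulfI c10); apply: (mulfI c20); rewrite mulrA [RHS]mulrA.
  transitivity (c2 * (F e * c1)); first by ring.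
  by rewrite -E; ring.
have ef1 : e.1 = f.1.
  have h := key (fun P => mono (l%:Z, 0%N) * dX P) _ coef_xdX _.
  have {h}: e.1%:~R / l%:R = f.1%:~R / l%:R :> K.
    apply: h; rewrite mulrCA [RHS]mulrCA; congr (_ * _).
    rewrite /Z dXD -scaleN1r dXZ dXZ mulrDl mulrDr hx !scaleN1r mulrN mulNr; congr (_ - _).
    by rewrite -scalerAl -scalerAr.
  have lK : (l%:R : K) != 0.
    by have := intr_eq0_pchar ch0 l%:Z; rewrite -pmulrn => ->; rewrite -lt0n.
  move=> /(divIf lK)/eqP; rewrite -subr_eq0 -rmorphB intr_eq0_pchar // subr_eq0.
  by move/eqP.
have ef2 : e.2 = f.2.
  have h := key (fun P => mono (0, 1%N) * dY P) _ coef_ydY _.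
  have {h}: e.2%:R = f.2%:R :> K.
    apply: h; rewrite mulrCA [RHS]mulrCA; congr (_ * _).
    rewrite /Z dYD -scaleN1r dYZ dYZ mulrDl mulrDr hy !scaleN1r mulrN mulNr; congr (_ - _).
    by rewrite -scalerAl -scalerAr.
  move=> /eqP; rewrite -subr_eq0 !pmulrn -rmorphB intr_eq0_pchar // subr_eq0.
  by move=> /eqP[].
have fe : f = e by rewrite [f]surjective_pairing -ef1 -ef2 -surjective_pairing.
by case/vert_spec: vf => + _ _ _; rewrite fe Ze eqxx.
Qed.

(** The Euler identities of [X] and [Y] have the same factor [z]; together with [X, Y] = 0 they
    yield equal logarithmic derivatives. *)
Lemma brk0_prop d X Y : hom dirQ d X -> hom dirQ d Y -> X != 0 -> Y != 0 -> d != 0 ->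
  brk X Y = 0 -> exists2 c, c != 0 & X = c *: Y.
Proof.
move=> hX hY X0 Y0 d0 XY; have [z zE EX] := euler hX X0; have [z' zE' EY] := euler hY Y0.
have zz : z' = z by apply/eqP; rewrite -(eqr_int rat) zE zE'.
have zK : z%:~R != 0 :> K.
  by rewrite intr_eq0_pchar // -(intr_eq0 rat) zE mulf_neq0 // lQ0.
rewrite zz in EY; move: XY; rewrite /brk => XY.
have can P Q : z%:~R *: P = z%:~R *: Q -> P = Q by apply: scalerI.
apply: log_derivative_prop => //; apply: can; rewrite !scalerAl -EX -EY !mulrDl -!scalerAl;
  apply/eqP; rewrite -subr_eq0; apply/eqP.
- transitivity ((l%:Z * u.2)%:~R *: (mono (0, 1%N) * - (dX X * dY Y - dX Y * dY X))).
    rewrite opprD addrACA -!scalerBr; set x := mono (l%:Z, _); set y := mono (0, _).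
    have -> : x * dX X * dX Y - x * dX Y * dX X = 0 by ring.
    by rewrite scaler0 add0r; congr (_ *: _); ring.
  by rewrite XY oppr0 mulr0 scaler0.
transitivity ((l%:Z * u.1)%:~R *: (mono (l%:Z, 0%N) * (dX X * dY Y - dX Y * dY X))).
  rewrite opprD addrACA -!scalerBr; set x := mono (l%:Z, _); set y := mono (0, _).
  have -> : y * dY X * dY Y - y * dY Y * dY X = 0 by ring.
  by rewrite scaler0 addr0; congr (_ *: _); ring.
by rewrite XY mulr0 scaler0.
Qed.
End Direction.
End HomogeneousRoots.

(** * Homogeneous elements as polynomials in one monomial *)

Section Decomposition.
Context (l : nat) (l0 : (0 < l)%N) (K : fieldType) (ch0 : [pchar K] =i pred0).
Context (L : comAlgType K) (M : laurent_model l L).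
Implicit Types (P Q R S X Y Z N D : L) (e f g : int * nat) (c : K) (d : rat).
Local Notation coef := (coef M).
Local Notation mono := (mono M).
Local Notation supp := (supp M).
Local Notation brk := (brk M).
Local Notation wgt := (wgt l).
Local Notation hom := (hom M).
Local Notation part := (part M).

(** Dividing by the gcd gives a primitive orthogonal vector, which generates the integer points of
    the line. *)
Lemma lattice_line (u1 u2 : int) : (u1, u2) != 0 ->
  exists2 t : int * nat, t != (0, 0%N) &
    forall x y : int, u1 * x + u2 * y = 0 -> exists k : int, x = k * t.1 /\ y = k * t.2%:Z.
Proof.
move=> u0; pose g := gcdz u1 u2.
have g0 : g != 0 by rewrite /g gcdz_eq0 negb_and; move: u0; rewrite xpair_eqE negb_and.
have [a' Ea] : exists a', u1 = a' * g by apply/dvdzP; apply: dvdz_gcdl.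
have [b' Eb] : exists b', u2 = b' * g by apply/dvdzP; apply: dvdz_gcdr.
have cop : coprimez a' b'.
  have : g = gcdz a' b' * g.
    by rewrite {1}/g Ea Eb -mulz_gcdl.
  by rewrite -[X in X = _]mul1r => /(mulIf g0) h; rewrite /coprimez -h.
have key (x y : int) : u1 * x + u2 * y = 0 -> exists k, x = - k * b' /\ y = k * a'.
  rewrite Ea Eb => h; have {}h : a' * x = - (b' * y).
    by apply: (mulfI g0); apply/eqP; rewrite -subr_eq0; apply/eqP; rewrite -h; ring.
  have : (a' %| y)%Z.
    rewrite -(Gauss_dvdzr _ cop); apply/dvdzP; exists (- x).
    by rewrite mulNr [x * _]mulrC h opprK.
  move/dvdzP=> [k yE]; have [a0|an0] := eqVneq a' 0.
    (* Here [b'] is 1 or -1 and [y] is 0, so the multiplier is read off from [x]. *)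
    have b1 : b' * b' = 1.
      have : `|b'|%N = 1%N by move: cop; rewrite a0 /coprimez gcd0z => /eqP[].
      by case: (b') => [[|[|n]]|[|n]].
    exists (- (x * b')); rewrite yE a0 !mulr0; split=> //.
    by rewrite opprK -mulrA b1 mulr1.
  by exists k; split=> //; apply: (mulfI an0); rewrite h yE; ring.
have ab0 : (a' != 0) || (b' != 0).
  by rewrite -negb_and; apply: contraNN u0 => /andP[/eqP a0 /eqP b0]; rewrite Ea Eb a0 b0
    !mul0r.
(* The sign of the generator is chosen to make its second coordinate a natural number. *)
case: a' {Ea cop} key ab0 => [n|n] key ab0.
  exists (- b', n); first by rewrite xpair_eqE oppr_eq0 andbC -negb_and in ab0 *.
  by move=> x y /key[k [-> ->]]; exists k; split=> //=; ring.
exists (b', n.+1); first by rewrite xpair_eqE andbF.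
by move=> x y /key[k [-> ->]]; exists (- k); rewrite NegzE; split=> //=; ring.
Qed.

Section Line.
Context (t : int * nat) (t0 : t != (0, 0%N)).

Definition shift e (i : nat) : int * nat := (e.1 + t.1 *+ i, (e.2 + t.2 * i)%N).

(** Evaluation at the monomial with exponent [t]; a homogeneous element is a monomial times such a
    value. *)
Definition psi (p : {poly K}) : L := horner_alg (mono t) p.

Lemma shift_inj e : injective (shift e).
Proof.
move=> i j [/addrI h1 /addnI h2].
case: t t0 h1 h2 => t1 [|t2] /= tn0 h1 h2.
  have t10 : t1 != 0 by move: tn0; rewrite xpair_eqE eqxx andbT.
  exact: (mulrIn t10).
by apply/eqP; rewrite -(eqn_pmul2l (ltn0Sn t2)) h2.
Qed.

Lemma monoX e i : mono e ^+ i = mono (e.1 *+ i, (e.2 * i)%N).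
Proof.
elim: i => [|i IH]; first by rewrite expr0 mulr0n muln0 mono1.
by rewrite exprS IH monoM /= mulrS mulnS.
Qed.

Lemma mono_psi e p : mono e * psi p = \sum_(i < size p) p`_i *: mono (shift e i).
Proof.
rewrite /psi -{1}(coefK p) poly_def linear_sum mulr_sumr; apply: eq_bigr => i _ /=.
by rewrite linearZ /= rmorphXn /= horner_algX monoX mulr_algl -scalerAr monoM.
Qed.

Lemma coef_mono_psi e p i : coef (mono e * psi p) (shift e i) = p`_i.
Proof.
rewrite mono_psi coef_sum.
rewrite (eq_bigr (fun j : 'I_(size p) => if j == i :> nat then p`_i else 0)); last first.
  move=> j _; rewrite coefZ coef_mono (inj_eq (shift_inj (e := e))).
  by case: eqP => [->|_]; rewrite ?mulr1 ?mulr0.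
have [ip|ip] := ltnP i (size p).
  rewrite (bigD1 (Ordinal ip)) //= eqxx big1 ?addr0 // => j.
  by rewrite -val_eqE /= => /negbTE ->.
rewrite nth_default // big1 // => j _.
by case: ifP.
Qed.

Lemma supp_mono_psi e p f : coef (mono e * psi p) f != 0 -> exists i, f = shift e i.
Proof.
suff: supported M (fun f => exists i, f = shift e i) (mono e * psi p) by apply.
rewrite mono_psi; apply: supported_sum => i _; apply: supportedZ; apply: supported_mono.
by exists i.
Qed.

(** A nonzero constant term makes [e] the first exponent in the progression of step [t], so [e] and
    [e'] are shifts of each other only if they are equal. *)
Lemma mono_psi_inj e e' (p p' : {poly K}) : p`_0 != 0 -> p'`_0 != 0 ->
  mono e * psi p = mono e' * psi p' -> e = e' /\ p = p'.
Proof.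
have sh0 f : shift f 0 = f by rewrite /shift mulr0n addr0 muln0 addn0 -surjective_pairing.
move=> p0 p0' E.
have [i Ei] : exists i, e = shift e' i.
  by apply: (supp_mono_psi (p := p')); rewrite -E -{2}(sh0 e) coef_mono_psi.
have [j Ej] : exists j, e' = shift e j.
  by apply: (supp_mono_psi (p := p)); rewrite E -{2}(sh0 e') coef_mono_psi.
have ij : shift e (i + j) = shift e 0.
  rewrite sh0 [RHS]Ei [in RHS]Ej /shift /=; congr pair; first by rewrite mulrnDr addrA
    addrAC.
  by rewrite mulnDr addnA addnAC.
have /eqP := shift_inj ij; rewrite addn_eq0 => /andP[/eqP i0 _].
have ee : e = e' by rewrite Ei i0 sh0.
by split=> //; apply/polyP => k; rewrite -(coef_mono_psi e) E ee coef_mono_psi.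
Qed.

(** All exponents differ by integer multiples of [t]; counted from the extreme one, the multiples
    are nonnegative. *)
Lemma psi_decomposition N : N != 0 ->
  (forall e f, coef N e != 0 -> coef N f != 0 -> exists k : int,
      e.1 - f.1 = k * t.1 /\ e.2%:Z - f.2%:Z = k * t.2%:Z) ->
  exists e (p : {poly K}), p`_0 != 0 /\ N = mono e * psi p.
Proof.
move=> /(supp0 M)[e1 e1N] line.
(* Minus the scalar product with [t]: its maximum selects the first exponent in the direction of
   [t]. *)
pose F e : rat := - (e.1 * t.1 + e.2%:Z * t.2%:Z)%:~R.
have [|e0 e0N he] := @max_exists _ (supp N) F e1; first by rewrite mem_supp.
rewrite mem_supp in e0N.
have sh e : e \in supp N -> exists i, e = shift e0 i.
  move=> eN; have := he e eN; rewrite mem_supp in eN; have [k [h1 h2]] := line _ _ eN e0N.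
  rewrite /F lerN2 ler_int => le.
  have tt : 0 < t.1 * t.1 + t.2%:Z * t.2%:Z.
    rewrite -!expr2 lt_neqAle addr_ge0 ?sqr_ge0 // andbT eq_sym paddr_eq0 ?sqr_ge0 //.
    by rewrite !sqrf_eq0; move: t0; rewrite {1}[t]surjective_pairing xpair_eqE.
  have k0 : 0 <= k.
    rewrite -(pmulr_lge0 _ tt); have -> : k * (t.1 * t.1 + t.2%:Z * t.2%:Z) =
      (e.1 * t.1 + e.2%:Z * t.2%:Z) - (e0.1 * t.1 + e0.2%:Z * t.2%:Z).
      by rewrite mulrDr !mulrA -h1 -h2; ring.
    by rewrite subr_ge0.
  case: k k0 h1 h2 => // i _ h1 h2; exists i; rewrite [e]surjective_pairing; congr pair.
    by rewrite /= -mulr_natl natz -h1 addrC subrK.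
  by apply/eqP; rewrite /= -eqz_nat PoszD PoszM mulrC -h2 addrC subrK.
have [p Np] : exists p : {poly K}, N = mono e0 * psi p.
  rewrite (coef_expand M N); elim: (supp N) sh => [|e r IH] sh.
    by exists 0; rewrite big_nil /psi rmorph0 mulr0.
  have [|p IHp] := IH; first by move=> f fr; apply: sh; rewrite inE fr orbT.
  have [i ei] := sh e (mem_head _ _).
  exists ((coef N e)%:P * 'X^i + p); rewrite big_cons IHp /psi rmorphD mulrDr; congr (_ +
    _).
  by rewrite rmorphM rmorphXn /= horner_algC horner_algX monoX mulr_algl -scalerAr monoM;
    congr (_ *: mono _).
exists e0, p; split=> //; rewrite -(coef_mono_psi e0) -Np.
by rewrite /shift mulr0n addr0 muln0 addn0 -surjective_pairing.
Qed.

(** Uniqueness of the decomposition splits the equation into one of monomials and one of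
    polynomials. In K[X] divisibility of q-th powers gives divisibility; for the monomials only the
    y-exponents have to be compared, x being invertible. *)
Lemma psi_dvd N D S q : (0 < q)%N ->
  (forall P, P = N \/ P = D \/ P = S -> exists e (p : {poly K}), p`_0 != 0 /\ P = mono e
    * psi p) ->
  N ^+ q = S * D ^+ q -> exists R, N = R * D.
Proof.
move=> q0 dec E.
have [|eN [pN [pN0 EN]]] := dec N; first by left.
have [|eD [pD [pD0 ED]]] := dec D; first by right; left.
have [|eS [pS [pS0 ES]]] := dec S; first by right; right.
move: E; rewrite EN ED ES !exprMn -/(psi _) !monoX mulrACA monoM.
rewrite /psi -!rmorphXn -rmorphM => /mono_psi_inj[||].
- by rewrite -horner_coef0 horner_exp horner_coef0 expf_neq0.
- by rewrite -!horner_coef0 hornerM horner_exp !horner_coef0 mulf_neq0 // expf_neq0.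
move=> [_ h2] h3.
have le2 : (eD.2 <= eN.2)%N by rewrite -(leq_pmul2r q0) h2 leq_addl.
have : pD %| pN by rewrite -(dvdp_pexp2r _ _ q0) h3 dvdp_mull.
move=> /dvdpP[h hE]; exists (mono (eN.1 - eD.1, (eN.2 - eD.2)%N) * psi h).
rewrite hE /psi rmorphM mulrACA monoM /= subrK subnK //.
by rewrite -surjective_pairing.
Qed.
End Line.
End Decomposition.

(** * Roots of homogeneous elements *)

Section Roots.
Context (l : nat) (l0 : (0 < l)%N) (K : fieldType) (ch0 : [pchar K] =i pred0).
Context (L : comAlgType K) (M : laurent_model l L).
Context (u : int * int) (u0 : u != 0).
Implicit Types (A B C P Q R S T X Y N D G H : L) (e f : int * nat) (c : K) (d : rat).
Local Notation coef := (coef M).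
Local Notation mono := (mono M).
Local Notation brk := (brk M).
Local Notation part := (part M).
Local Notation hom := (hom M (dirQ u)).

Lemma hom_partM d1 d2 R D : hom d2 D ->
  part (dirQ u) (d1 + d2) (R * D) = part (dirQ u) d1 R * D.
Proof.
move=> hD; set r := part _ _ R; have -> : R * D = r * D + (R - r) * D by ring.
rewrite partD (hom_part (homM (@part_hom _ _ _ M _ d1 R) hD)).
suff -> : part (dirQ u) (d1 + d2) ((R - r) * D) = 0 by rewrite addr0.
have : supported M (fun e => wgt l (dirQ u) e != d1 + d2) ((R - r) * D).
  apply: (supportedM (Z1 := fun e => wgt l (dirQ u) e != d1) _ _ hD).
    by move=> e f h <-; rewrite wgtD (inj_eq (addIr _)).
  by move=> e; rewrite coefB coef_part; case: (_ =P d1) => [_|/eqP //]; rewrite subrr eqxx.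
move=> h; apply: (coef_inj M) => e; rewrite coef_part coef0; case: (_ =P d1 + d2) => // we.
by apply/eqP/negPn/negP => /h; rewrite we eqxx.
Qed.

(** The exponents of a homogeneous element lie on a lattice line orthogonal to [u], where [psi_dvd]
    applies; the component of the quotient in the expected weight is already a quotient. *)
Lemma hom_dvd dN dD dS N D S q : (0 < q)%N -> hom dN N -> hom dD D -> hom dS S ->
  N != 0 -> D != 0 -> S != 0 -> N ^+ q = S * D ^+ q ->
  exists2 R, hom (dN - dD) R & N = R * D.
Proof.
move=> q0 hN hD hS N0 D0 S0 E.
(* In the integer coordinates of exponents, whose first entry counts multiples of 1/l, the second
   entry of the direction is scaled by [l]. *)
have ul0 : (u.1, l%:Z * u.2) != 0.
  move: u0; rewrite [u in u == _]surjective_pairing !xpair_eqE /= mulf_eq0.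
  by rewrite eqz_nat (gtn_eqF l0).
have [t t0 ht] := lattice_line ul0.
have dec d P : hom d P -> P != 0 -> exists e (p : {poly K}), p`_0 != 0 /\ P = mono e *
  psi M t p.
  move=> hP P0; apply: (psi_decomposition t0 P0) => e f eP fP; apply: ht.
  have : izw l u e = izw l u f.
    by apply/eqP; rewrite -(eqr_int rat) !izwE // (hP _ eP) (hP _ fP).
  rewrite /izw /= => /eqP; rewrite -subr_eq0 => /eqP <-; ring.
have [|R NR] := @psi_dvd _ _ _ M t t0 N D S q q0 _ E.
  by move=> P [->|[->|->]]; [exact: dec hN N0|exact: dec hD D0|exact: dec hS S0].
exists (part (dirQ u) (dN - dD) R); first exact: part_hom.
by rewrite -(hom_partM _ _ hD) subrK -NR hom_part.
Qed.

(** With [al * p = be * q + 1], the power [al] of the equation reads A D^q = c^al N^q for N = B^al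
    and D = C^al A^be, so [A] is, up to a scalar, the q-th power of N / D, which exists by
    [hom_dvd]. *)
Lemma coprime_root dA dB dC A B C p q c :
  (0 < p)%N -> (0 < q)%N -> coprime p q -> c != 0 ->
  hom dA A -> hom dB B -> hom dC C -> A != 0 -> B != 0 -> C != 0 ->
  A ^+ p * C ^+ q = c *: B ^+ q ->
  exists R c', [/\ c' != 0, A = c' *: R ^+ q & exists d, hom d R].
Proof.
move=> p0 q0 pq c0 hA hB hC A0 B0 C0 E.
have [al be] := egcdnP q p0; rewrite (eqP pq) => bez _.
pose N := B ^+ al; pose D := C ^+ al * A ^+ be.
have hN : hom (dB * al%:R) N by apply: homX.
have hD : hom (dC * al%:R + dA * be%:R) D by apply: homM; apply: homX.
have xn0 P n : P != 0 -> P ^+ n != 0 by apply: (exp_neq0 l0 M).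
have N0 : N != 0 by apply: xn0.
have D0 : D != 0 by apply: (mul_neq0 l0 M); apply: xn0.
pose S := (c ^- al) *: A.
have S0 : S != 0 by rewrite scaler_eq0 invr_eq0 expf_eq0 (negbTE c0) andbF.
have hS : hom dA S by apply: supportedZ.
have ND : N ^+ q = S * D ^+ q.
  have AD : A * D ^+ q = c ^+ al *: N ^+ q.
    transitivity ((A ^+ p * C ^+ q) ^+ al).
      rewrite /D !exprMn -!exprM mulrCA -exprS mulrC [(p * al)%N]mulnC bez addn1.
      by rewrite [(q * al)%N]mulnC.
    by rewrite E exprZn /N -!exprM mulnC.
  by rewrite /S -scalerAl AD scalerA mulVf ?scale1r // expf_neq0.
have [R hR NR] := hom_dvd q0 hN hD hS N0 D0 S0 ND.
exists R, (c ^+ al); split; [exact: expf_neq0| |by eexists; exact: hR].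
have RS : R ^+ q = S.
  apply: (mul_cancel l0 M (xn0 D q D0)); rewrite mulrC -exprMn -NR ND; exact: mulrC.
by rewrite RS scalerA mulfV ?scale1r // expf_neq0.
Qed.

Lemma brkXl X Y n : brk X Y = 0 -> brk (X ^+ n) Y = 0.
Proof.
move=> h; elim: n => [|n IH]; first by rewrite expr0 brk1l.
by rewrite exprS brkMl h IH !mulr0 addr0.
Qed.

Lemma brkX_eq0 X Y n : (0 < n)%N -> Y != 0 -> brk X (Y ^+ n) = 0 -> brk X Y = 0.
Proof.
move=> n0 Y0; have E k : brk X (Y ^+ k) = k%:R *: (Y ^+ k.-1 * brk X Y).
  elim: k => [|k IH]; first by rewrite expr0 scale0r brkC brk1l oppr0.
  rewrite exprS brkMr IH; case: k {IH} => [|k]; first by rewrite expr0 scale0r scale1r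
    mulr0 add0r.
  rewrite -scalerAr /= mulrA -exprS -[X in _ + X]scale1r -scalerDl.
  by rewrite natr1.
rewrite E => /eqP; rewrite scaler_eq0.
have -> : (n%:R == 0 :> K) = false.
  by have := intr_eq0_pchar ch0 n%:Z; rewrite -pmulrn => ->; rewrite eqz_nat (gtn_eqF n0).
move=> /eqP h; apply/eqP/negPn/negP => b0.
by have := mul_neq0 l0 M (exp_neq0 l0 M n.-1 Y0) b0; rewrite h eqxx.
Qed.

(** Two degree coincidences become proportionalities: S^n with T^m makes [S] a multiple of some R^m,
    then R^p H^q with (G S)^q makes [R] a multiple of a q-th power. Each root comes from
    [coprime_root], the first time with [C] equal to 1. *)
Lemma homogeneous_power dS dT dG dH S T G H (m n p q : nat) :
  (0 < m)%N -> (0 < n)%N -> (0 < p)%N -> (0 < q)%N -> coprime m n -> coprime p q ->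
  hom dS S -> hom dT T -> hom dG G -> hom dH H ->
  S != 0 -> T != 0 -> G != 0 -> H != 0 -> 0 < dS -> 0 <= dG ->
  m%:R * dT = n%:R * dS -> q%:R * m%:R * (dG + dS - dH) = p%:R * dS ->
  brk T S = 0 -> brk G S = 0 -> brk H S = 0 ->
  exists R c, [/\ c != 0, S = c *: R ^+ (q * m) & exists d, hom d R].
Proof.
move=> m0 n0 p0 q0 mn pq hS hT hG hH S0 T0 G0 H0 dS0 dG0 dTE dHE bT bG bH.
have m0' : (m%:R : rat) != 0 by rewrite pnatr_eq0 -lt0n.
have q0' : (q%:R : rat) != 0 by rewrite pnatr_eq0 -lt0n.
have dS1 := lt0r_neq0 dS0.
have xn0 P k : P != 0 -> P ^+ k != 0 by apply: (exp_neq0 l0 M).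
have sn d P k : hom d P -> hom (k%:R * d) (P ^+ k) by rewrite mulrC; apply: homX.
have [c c0 E] : exists2 c, c != 0 & S ^+ n = c *: T ^+ m.
  apply: (brk0_prop l0 ch0 (sn _ _ n hS) _ (xn0 _ _ S0) (xn0 _ _ T0)).
  - by rewrite -dTE; apply: sn.
  - by rewrite mulf_neq0 // pnatr_eq0 -lt0n.
  by apply: brkXl; rewrite brkC (brkXl _ bT) oppr0.
have [R [c1 [c10 SE [dR hR]]]] : exists R c', [/\ c' != 0, S = c' *: R ^+ m & exists d,
  hom d R].
  have h1 : hom 0 1 by apply: hom1.
  have nm : coprime n m by rewrite coprime_sym.
  have E1 : S ^+ n * 1 ^+ m = c *: T ^+ m by rewrite expr1n mulr1.
  exact: (coprime_root n0 m0 nm c0 hS hT h1 S0 T0 (oner_neq0 _) E1).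
have R0 : R != 0.
  by apply: contraNneq S0 => R0; rewrite SE R0 expr0n (gtn_eqF m0) scaler0.
have dRE : m%:R * dR = dS.
  have h : hom (m%:R * dR) S by rewrite SE; apply: supportedZ; apply: sn.
  by rewrite -(deg_hom S0 h).1 (deg_hom S0 hS).1.
have bR X : brk X S = 0 -> brk X R = 0.
  rewrite SE brkZr => /eqP; rewrite scaler_eq0 (negbTE c10) => /eqP.
  exact: brkX_eq0.
have bRS : brk R S = 0 by rewrite brkC bR ?brkPP ?oppr0.
have [c2 c20 E2] : exists2 c, c != 0 & R ^+ p * H ^+ q = c *: (G * S) ^+ q.
  apply: (brk0_prop l0 ch0 (d := q%:R * (dG + dS))).
  - have -> : q%:R * (dG + dS) = p%:R * dR + q%:R * dH.
      apply: (mulfI m0'); move: dHE; rewrite -dRE; lra.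
    by apply: homM; apply: sn.
  - by apply: sn; apply: homM.
  - by apply: (mul_neq0 l0 M); apply: xn0.
  - by apply: xn0; apply: (mul_neq0 l0 M).
  - by rewrite mulf_neq0 // lt0r_neq0 // ltr_wpDl.
  apply: (brk_trans l0 ch0 hS S0 dS1).
    by rewrite brkMl !brkXl ?mulr0 ?addr0.
  by apply: brkXl; rewrite brkMl brkPP bG !mulr0 addr0.
have [R' [c3 [c30 RE hR']]] := coprime_root p0 q0 pq c20 hR (homM hG hS) hH R0
  (mul_neq0 l0 M G0 S0) H0 E2.
exists R', (c1 * c3 ^+ m); split=> //; first by rewrite mulf_neq0 ?expf_neq0.
by rewrite SE RE exprZn scalerA exprM.
Qed.
End Roots.

(** * Nilpotency of the bracket with P, and the leading form of P as a power *)

Section Main.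
Context (l : nat) (l0 : (0 < l)%N) (K : fieldType) (ch0 : [pchar K] =i pred0).
Context (L : comAlgType K) (M : laurent_model l L).
Implicit Types (P Q R S F G X Y : L) (e f g : int * nat) (c : K) (a b w : rat * rat).
Local Notation coef := (coef M).
Local Notation brk := (brk M).
Local Notation wgt := (wgt l).
Local Notation deg := (deg M).
Local Notation ldg := (ldg M).
Local Notation vert := (vert M).
Local Notation hom := (hom M).

Section Nilpotent.
Variables (P Q : L) (c : K).
Hypothesis (bPQ : brk P Q = c%:A).
Local Notation D := (fun X => brk X P).

Lemma iter_brkD X Y i : iter i D (X + Y) = iter i D X + iter i D Y.
Proof. by elim: i => //= i ->; rewrite brkDl. Qed.

Lemma iter_brk0 i : iter i D 0 = 0.
Proof. by elim: i => //= i ->; rewrite brk0l. Qed.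

Lemma iter_brk_ge X i k : (i <= k)%N -> iter i D X = 0 -> iter k D X = 0.
Proof. by move=> /subnK <- h; rewrite iterD h iter_brk0. Qed.

(** By the Leibniz rule one bracket turns X Y into X [Y, P] + Y [X, P], where one factor in each
    term has a lower order of nilpotency. *)
Lemma iter_brkM s i k X Y : (i + k <= s)%N -> iter i D X = 0 -> iter k D Y = 0 ->
  iter s D (X * Y) = 0.
Proof.
elim: s i k X Y => [|s IH] [|i] [|k] X Y //=.
- by move=> _ -> _; rewrite mul0r.
- by move=> _ -> _; rewrite mul0r iter_brk0 brk0l.
- by move=> _ -> _; rewrite mul0r iter_brk0 brk0l.
- by move=> _ _ ->; rewrite mulr0 iter_brk0 brk0l.
have comm j Z : brk (iter j D Z) P = iter j D (brk Z P) by rewrite -iterSr.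
rewrite !comm addSn ltnS => ik hX hY; rewrite brkMl iter_brkD.
rewrite (IH i.+1 k) ?add0r //; [|by rewrite addSnnS|by rewrite /= comm].
by rewrite (IH k.+1 i) //; [rewrite addnC|rewrite /= comm].
Qed.

(** [P, P] is 0 and [Q, P] is a constant; sums and products preserve nilpotency. *)
Lemma subalg_gen_nilpotent G : subalg_gen P Q G -> exists i, iter i D G = 0.
Proof.
elim=> [|||X Y _ [i hi] _ [k hk]|X Y _ [i hi] _ [k hk]].
- by exists 1%N; rewrite /= brkPP.
- by exists 2%N; rewrite /= [brk Q P]brkC bPQ -scaleNr brkZl brk1l scaler0.
- by move=> d; exists 1%N; rewrite /= brkZl brk1l scaler0.
- exists (maxn i k); rewrite iter_brkD (iter_brk_ge _ hi) ?leq_maxl //.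
  by rewrite (iter_brk_ge _ hk) ?leq_maxr // addr0.
- by exists (i + k)%N; apply: (iter_brkM (leqnn _) hi hk).
Qed.
End Nilpotent.

(** On a line of constant weight [a], all tie-breakers clockwise of [a] order the exponents in the
    same way. *)
Lemma vert_perp a b b' P e : cross a b < 0 -> cross a b' < 0 ->
  vert a b P e -> vert a b' P e.
Proof.
move=> ab ab' ve; have P0 := vert_neq0 ve; apply/(vertP M a b' e P0).
have [eP h] := (vertP M a b e P0).1 ve; split=> // f fP; have [h1 h2] := h f fP.
split; first exact: h1.
move=> h3; have := h2 h3; move: h3; rewrite /wgt.
move: (e.1%:~R / l%:R) (f.1%:~R / l%:R) (e.2%:R : rat) (f.2%:R : rat) => x x' y y' ha hb.
have {}ha : a.1 * (x' - x) + a.2 * (y' - y) = 0 by lra.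
have {}hb : b.1 * (x' - x) + b.2 * (y' - y) <= 0 by lra.
suff : b'.1 * (x' - x) + b'.2 * (y' - y) <= 0 by lra.
move: (x' - x) (y' - y) ha hb => X Y ha hb; clear -ha hb ab ab'.
have a2 : 0 < a.1 * a.1 + a.2 * a.2.
  rewrite -!expr2 lt_neqAle addr_ge0 ?sqr_ge0 // andbT eq_sym paddr_eq0 ?sqr_ge0 //.
  apply: contraTN ab; rewrite !sqrf_eq0 => /andP[/eqP a10 /eqP a20].
  by rewrite /cross a10 a20 !mul0r subrr ltxx.
(* The scalar product of [d] with (X, Y), resolved along [a] and orthogonally to it. *)
have id d : (a.1 * a.1 + a.2 * a.2) * (d.1 * X + d.2 * Y) =
    cross a d * (a.1 * Y - a.2 * X) + (d.1 * a.1 + d.2 * a.2) * (a.1 * X + a.2 * Y).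
  by rewrite /cross; ring.
have tpos : 0 <= a.1 * Y - a.2 * X.
  rewrite -(nmulr_rle0 _ ab); have := id b; rewrite ha mulr0 addr0 => <-.
  by rewrite pmulr_rle0.
by rewrite -(pmulr_rle0 _ a2) id ha mulr0 addr0 nmulr_rle0.
Qed.

(** A scalar [c'] remains because [K] is an arbitrary field of characteristic zero here; it is
    absorbed later by a root in an algebraically closed field. *)
Lemma model_power (P Q F G0 : L) (c : K) (dF : rat) (u0 u : int * int) (a : int)
    (b m n p q : nat) (eF : int * nat) (v : rat * rat) :
  let d0 := dirQ u0 in let d := dirQ u in
  P != 0 -> Q != 0 -> brk P Q = c%:A ->
  cross d0 v < 0 ->
  vert d0 v P (a *+ m, (b * m)%N) -> vert d0 v Q (a *+ n, (b * n)%N) ->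
  hom d0 dF F -> vert d0 v F eF -> eF.1 *+ q = a *+ p -> (eF.2 * q = b * p)%N ->
  0 < deg d0 P -> 0 <= d0.1 + d0.2 -> (0 < b)%N -> l%:Z * b%:Z < a ->
  (0 < m)%N -> (0 < n)%N -> (0 < p)%N -> (0 < q)%N -> coprime m n -> coprime p q ->
  subalg_gen P Q G0 -> G0 != 0 ->
  brk (ldg d0 G0) (ldg d0 P) * F = ldg d0 G0 * ldg d0 P ->
  (forall i, (0 < i)%N -> brk (ldg d0 (iter i (fun G => brk G P) G0)) (ldg d0 P) = 0) ->
  u != 0 -> inner M P d0 d -> reach (inner M P d0) d0 d ->
  exists R c', [/\ c' != 0, ldg d P = c' *: R ^+ (q * m) & exists dR, hom d dR R].
Proof.
move=> d0 d P0 Q0 bPQ d0v vP vQ hF vF eF1 eF2 dP0 C0 b0 lba m0 n0 p0 q0 mn pq.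
move=> gen G00 GF Gi un0 id rd; set e0 := (a *+ m, (b * m)%N) in vP.
have d0v' : cross d0 v != 0 by rewrite lt_eqF.
pose k : rat := e0.2%:R.
have k0 : 0 < k by rewrite ltr0n muln_gt0 b0.
have lQ := lQ0 l0.
have lQp : 0 < (l%:R : rat) by rewrite ltr0n.
have e0b : e0.2%:R < e0.1%:~R / l%:R :> rat.
  rewrite ltr_pdivlMr // -natrM pmulrn ltr_int /e0 /= -mulr_natr natz !PoszM.
  by rewrite mulrAC ltr_pM2r ?ltz_nat // mulrC.
have [e0P we0 _ _] := vert_spec vP.
have al X g : vert d0 v X g -> g.1 * e0.2%:Z = e0.1 * g.2%:Z ->
    aligned M k P g.2%:R X d0.
  move=> vg cr b' e g' db' ve' vg' a'.
  have d0b' : cross d0 b' != 0 by rewrite lt_eqF.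
  rewrite (vert_uniq l0 d0b' ve' (vert_perp d0v db' vP)).
  rewrite (vert_uniq l0 d0b' vg' (vert_perp d0v db' vg)) /wgt /k.
  have : g.1%:~R * e0.2%:R = e0.1%:~R * g.2%:R :> rat.
    by rewrite !pmulrn -!rmorphM cr.
  move=> E; rewrite !mulrDr; congr (_ + _); last by ring.
  transitivity (a'.1 / l%:R * (g.1%:~R * e0.2%:R)); first by ring.
  by rewrite E; ring.
have chain X g j' : X != 0 -> vert d0 v X g -> g.1 * e0.2%:Z = e0.1 * g.2%:Z ->
   (brk X P != 0 -> forall w, reach (inner M P d0) d0 w -> eqdeg M k P j' (brk X P) w) ->
   (forall w, reach (inner M P d0) d0 w -> eqdeg M k P g.2%:R X w) /\
   brk (ldg d X) (ldg d P) = 0.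
  move=> X0 vg cr hX; have alX := al X g vg cr.
  have eqX w : reach (inner M P d0) d0 w -> eqdeg M k P g.2%:R X w.
    move=> rw; apply: aligned_eqdeg => //.
      exact: (reach_neq0 P0 dP0 rw).
    exact: (chain_aligned l0 ch0 k0 P0 (esym we0) dP0 e0P e0b C0 X0 hX alX rw).
  split=> //.
  apply: (chain_brk0 l0 k0 P0 (esym we0) dP0 e0P e0b C0 X0 hX _ rd id (eqX _ rd)).
  exact: eqX (reach_start _ _).
have [eQ bQ] : (forall w, reach (inner M P d0) d0 w -> eqdeg M k P (b * n)%:R Q w) /\
    brk (ldg d Q) (ldg d P) = 0.
  (* [Q, P] is a constant, of degree 0 in every direction, hence the factor 0. *)
  apply: (chain Q (a *+ n, (b * n)%N) 0 Q0 vQ) => [|bn0 w rw] /=.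
    by rewrite -[a *+ m]mulr_natr -[a *+ n]mulr_natr !natz !PoszM; ring.
  rewrite /eqdeg mul0r brkC bPQ -scaleNr in bn0 *.
  have h : hom w 0 (- c *: 1) by apply: supportedZ; apply: hom1.
  by rewrite (deg_hom bn0 h).1 mulr0.
pose G i := iter i (fun X => brk X P) G0.
have exN : exists i, G i == 0.
  by have [i hi] := subalg_gen_nilpotent bPQ gen; exists i; rewrite /G hi.
have [N GN minN] := ex_minnP exN.
have Gn0 i : (i < N)%N -> G i != 0.
  by move=> iN; apply: contraTN iN => /minN; rewrite -leqNgt.
have [g0 vg0] := vert_exists M d0 v G00.
have GP0 : ldg d0 G0 * ldg d0 P != 0 by apply: (mul_neq0 l0 M); apply: ldg_neq0.
have nb : brk (ldg d0 G0) (ldg d0 P) != 0.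
  by apply: contraNneq GP0 => h; rewrite -GF h mul0r.
have lG1 : ldg d0 (G 1%N) = brk (ldg d0 G0) (ldg d0 P) by have [] := ldg_brk l0 G00 P0 nb.
have G10 : G 1%N != 0.
  by apply: contraNneq nb => h; rewrite -lG1 h /ldg blt_part //; exact: supported0.
have lv X g : vert d0 v X g -> vert d0 v (ldg d0 X) g by move=> vg; apply/vert_ldg.
have vGP := vertM l0 d0v' (lv _ _ vg0) (lv _ _ vP).
(* Otherwise the vertex of [G_0, P] would be [g0] plus [e0] minus the exponent of x y; the equation
   for [F] would then give [F] the vertex (1, 1), which lies on the diagonal and not below it. *)
have cr0 : g0.1 * e0.2%:Z = e0.1 * g0.2%:Z.
  apply/eqP/negPn/negP => cr; have := brk_vert l0 ch0 d0v' vg0 vP cr.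
  move=> vb; have := vertM l0 d0v' vb vF; rewrite GF => vGF.
  have := vert_uniq l0 d0v' vGP vGF => -[] h1 h2.
  have e1 : eF.1 = l%:Z.
    have cancelZ (x y z t : int) : x + y = x + y - z + t -> t = z by clear; lia.
    exact: (cancelZ _ _ _ _ h1).
  have bm0 : (0 < b * m)%N by rewrite muln_gt0 b0.
  have e2 : eF.2 = 1%N.
    have cancelN (x y z : nat) : (x + y = (x + y).-1 + z -> 0 < y -> z = 1)%N by clear; lia.
    exact: (cancelN _ _ _ h2 bm0).
  move: eF1 eF2; rewrite e1 e2 mul1n -[_ *+ q]mulr_natr -[_ *+ p]mulr_natr !natz => h3 h4.
  have : l%:Z * b%:Z * p%:Z = a * p%:Z by rewrite -h3 h4 PoszM mulrA.
  have pn0 : (p%:Z : int) != 0 by rewrite eqz_nat -lt0n.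
  by move=> /(mulIf pn0) E; rewrite E ltxx in lba.
have cri i g : (i < N)%N -> vert d0 v (G i) g -> g.1 * e0.2%:Z = e0.1 * g.2%:Z.
  case: i => [|i] iN vg; first by rewrite (vert_uniq l0 d0v' vg vg0).
  exact: (brk0_cross l0 ch0 d0v' vg vP (Gi i.+1 isT)).
have main i g : (i < N)%N -> vert d0 v (G i) g ->
    (forall w, reach (inner M P d0) d0 w -> eqdeg M k P g.2%:R (G i) w) /\
    brk (ldg d (G i)) (ldg d P) = 0.
  (* Descending induction on [i]: [chain] needs the degrees of [G_i, P], the next iterate. For the
     last nonzero iterate that bracket is 0 and the requirement is void. *)
  move=> iN; move: {2}(N - i)%N (leqnn (N - i)) => s.
  elim: s i g iN => [|s IH] i g iN; first by rewrite leqn0 subn_eq0 leqNgt iN.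
  move=> le vg; have [iN'|Ni] := ltnP i.+1 N; last first.
    apply: (chain _ g 0 (Gn0 i iN) vg (cri i g iN vg)) => bn0.
    have iE : i.+1 = N by apply/eqP; rewrite eqn_leq Ni iN.
    by move: bn0; rewrite -[brk _ P]/(G i.+1) iE GN.
  have [g' vg'] := vert_exists M d0 v (Gn0 _ iN').
  apply: (chain _ g g'.2%:R (Gn0 i iN) vg (cri i g iN vg)) => _.
  have le' : (N - i.+1 <= s)%N by rewrite subnS -ltnS prednK ?subn_gt0.
  exact: (IH i.+1 g' iN' le' vg').1.
have N1 : (1 < N)%N.
  rewrite ltnNge; apply/negP => N1; case: N N1 GN {minN Gn0 cri main} => [|[|]] // _.
    by rewrite (negbTE G00).
  by rewrite (negbTE G10).
have N0 := ltnW N1.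
have [g1 vg1] := vert_exists M d0 v G10.
have vGF := vertM l0 d0v' (lv _ _ vg1) vF.
(* The y-coordinate of the vertices on both sides of the equation for [F]. *)
have sum2 : (g1.2 + eF.2 = g0.2 + b * m)%N.
  by move: vGF; rewrite lG1 GF => vGF; case: (vert_uniq l0 d0v' vGF vGP).
have [eG0 bG0] := main 0%N g0 N0 vg0; have [eG1 bG1] := main 1%N g1 N1 vg1.
have dS0 : 0 < deg d P by case: id.
have kn0 : k != 0 by rewrite gt_eqF.
have bn0 : (b%:R : rat) != 0 by rewrite pnatr_eq0 -lt0n.
have mn0 : (m%:R : rat) != 0 by rewrite pnatr_eq0 -lt0n.
have := eQ d rd; have := eG0 d rd; have := eG1 d rd; rewrite /eqdeg => hG1 hG0 hQ.
apply: (@homogeneous_power _ l0 _ ch0 _ M u un0 (deg d P) (deg d Q) (deg d (G 0%N)) (deg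
  d (G 1%N))
  (ldg d P) (ldg d Q) (ldg d (G 0%N)) (ldg d (G 1%N)) m n p q) => //; try exact: part_hom;
  try by apply: ldg_neq0.
- by rewrite -(pmulr_rge0 _ k0) hG0 mulr_ge0 // ltW.
- apply: (mulfI bn0); move: hQ; rewrite /k /e0 /= !natrM mulrA => ->; ring.
(* In terms of y-exponents the relation says that q m times [eF.2] equals p k, where k = b m. *)
apply: (mulfI kn0).
transitivity (q%:R * m%:R * (k * deg d (G 0%N) + k * deg d P - k * deg d (G 1%N))).
  by ring.
rewrite hG0 hG1.
have {}sum2 : (g1.2%:R : rat) = g0.2%:R + k - eF.2%:R.
  by rewrite /k /e0 /= -natrD -sum2 natrD addrK.
rewrite sum2; transitivity (m%:R * (eF.2 * q)%:R * deg d P); first by rewrite natrM; ring.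
by rewrite eF2 /k /e0 /= !natrM; ring.
Qed.
End Main.

(** * Arcs of directions *)

Section Arc.
Context (l : nat) (l0 : (0 < l)%N) (K : fieldType) (L : comAlgType K) (M : laurent_model
  l L).
Implicit Types (u v : int * int) (w : rat * rat).

Lemma first_halfE u : first_half (0, -1) u = (0 < u.1) || ((u.1 == 0) && (u.2 < 0)).
Proof.
have h1 : cross (0, -1) u = u.1 by rewrite /cross /=; ring.
have h2 : dot (0, -1) u = - u.2 by rewrite /dot /=; ring.
by rewrite /first_half h1 h2 oppr_gt0.
Qed.

Lemma cross_dirQ u v : cross (dirQ u) (dirQ v) = (cross u v)%:~R.
Proof. by rewrite /cross rmorphB !rmorphM. Qed.

(** Clear denominators and divide by the gcd. Paths run through rational vectors, whereas positivity
    of the degree is given for coprime pairs. *)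
Lemma dir_ray w : w != 0 -> exists c u, [/\ 0 < c, is_dir u & w = (c * u.1%:~R, c *
  u.2%:~R)].
Proof.
case: w => x y wn0; pose X := numq x * denq y; pose Y := numq y * denq x.
pose g := gcdz X Y; have dx := denq_gt0 x; have dy := denq_gt0 y.
have XE : (X%:~R : rat) = x * (denq x * denq y)%:~R.
  by rewrite /X !rmorphM /= mulrA -numqE.
have YE : (Y%:~R : rat) = y * (denq x * denq y)%:~R.
  by rewrite /Y !rmorphM /= numqE; ring.
have D0 : (0 : rat) < (denq x * denq y)%:~R by rewrite ltr0z mulr_gt0.
have g0 : g != 0.
  apply: contraNneq wn0 => /eqP; rewrite gcdz_eq0 => /andP[/eqP X0 /eqP Y0].
  have x0 : x = 0 by apply: (mulIf (lt0r_neq0 D0)); rewrite -XE X0 mul0r.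
  have y0 : y = 0 by apply: (mulIf (lt0r_neq0 D0)); rewrite -YE Y0 mul0r.
  by rewrite x0 y0.
have gp : 0 < g by rewrite lt_neqAle eq_sym g0.
have [a Ea] : exists a, X = a * g by apply/dvdzP; apply: dvdz_gcdl.
have [b Eb] : exists b, Y = b * g by apply/dvdzP; apply: dvdz_gcdr.
exists (g%:~R / (denq x * denq y)%:~R), (a, b); split.
- by rewrite divr_gt0 // ltr0z.
- have : g = gcdz a b * g by rewrite {1}/g Ea Eb -mulz_gcdl.
  by rewrite -[X in X = _]mul1r => /(mulIf g0) h; rewrite /is_dir /coprimez -h.
congr pair => /=; apply: (mulIf (lt0r_neq0 D0)).
  by rewrite -XE Ea rmorphM /= mulrAC divfK ?lt0r_neq0 // mulrC.
by rewrite -YE Eb rmorphM /= mulrAC divfK ?lt0r_neq0 // mulrC.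
Qed.

Lemma deg_scale (c : rat) w P : 0 < c -> P != 0 ->
  deg M (c * w.1, c * w.2) P = c * deg M w P.
Proof.
move=> c0 P0; have E e : wgt l (c * w.1, c * w.2) e = c * wgt l w e.
  by rewrite /wgt /=; ring.
apply: degE.
  by move=> e eP; rewrite E ler_pM2l //; exact: (deg_ble w P0 eP).
have := ldg_neq0 M w P0; rewrite /ldg; congr (_ != 0).
by apply: (coef_inj M) => e; rewrite !coef_part E (inj_eq (mulfI (lt0r_neq0 c0))).
Qed.

(** Parallel primitive vectors are equal or opposite, and opposite ones lie in different
    half-planes. *)
Lemma same_half_eq u v : is_dir u -> is_dir v ->
  first_half (0, -1) u = first_half (0, -1) v -> cross u v = 0 -> u = v.
Proof.
rewrite !first_halfE /cross /is_dir; case: u v => [x y] [x' y'] /= du dv hf cr.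
have E : x * y' = y * x' by apply/eqP; rewrite -subr_eq0 cr.
have h1 : (x %| x')%Z.
  by rewrite -(Gauss_dvdzr _ du) -E; apply/dvdzP; exists y'; rewrite mulrC.
have h2 : (x' %| x)%Z.
  by rewrite -(Gauss_dvdzl _ dv) E; apply/dvdzP; exists y.
have h3 : (y %| y')%Z.
  by rewrite coprimez_sym in du; rewrite -(Gauss_dvdzr _ du) E; apply/dvdzP; exists x';
    rewrite mulrC.
have h4 : (y' %| y)%Z.
  by rewrite coprimez_sym in dv; rewrite -(Gauss_dvdzl _ dv) -E; apply/dvdzP; exists x.
have absE (s t : int) : (s %| t)%Z -> (t %| s)%Z -> s = t \/ s = - t.
  rewrite !dvdzE => st ts; have /eqP : `|s|%N == `|t|%N by rewrite eqn_dvd st.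
  by clear; lia.
have ex := absE _ _ h1 h2; have ey := absE _ _ h3 h4.
clear -ex ey hf cr du; case: ex ey hf cr => [->|->] [->|->] //= hf.
- have -> : x' * y' - - y' * x' = (x' * y') *+ 2 by ring.
  move=> /eqP; rewrite mulrn_eq0 mulf_eq0 /= => /orP[]/eqP z; last by rewrite z oppr0.
  by congr pair; move: hf; rewrite z eqxx ltxx /= => hf; clear -hf; lia.
- have -> : - x' * y' - y' * x' = (- x' * y') *+ 2 by ring.
  move=> /eqP; rewrite mulrn_eq0 mulf_eq0 /= oppr_eq0 => /orP[]/eqP z; first by rewrite z
    oppr0.
  by congr pair; move: hf; rewrite z ltxx !andbF !orbF => hf; clear -hf; lia.
by move=> _; congr pair; clear -hf; lia.
Qed.

Definition halfQ w := (0 < w.1) || ((w.1 == 0) && (w.2 < 0)).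

Lemma halfQ_ray (c : rat) v : 0 < c ->
  halfQ (c * v.1%:~R, c * v.2%:~R) = first_half (0, -1) v.
Proof.
move=> c0; rewrite first_halfE /halfQ /= pmulr_rgt0 // ltr0z mulf_eq0 gt_eqF //= intr_eq0.
by rewrite pmulr_rlt0 // ltrz0.
Qed.

(** One segment suffices when [u] and [u0] lie in the same half turn from (0, -1). Otherwise they
    may be a half turn or more apart, and the path passes through (0, 1). *)
Lemma arc_reach (P : L) (e0 : int * nat) u0 ut u :
  P != 0 -> is_dir u0 -> 0 <= u0.1 + u0.2 -> is_dir u ->
  coef M P e0 != 0 -> e0.2%:R < e0.1%:~R / l%:R :> rat ->
  wgt l (dirQ u0) e0 = deg M (dirQ u0) P -> 0 < deg M (dirQ u0) P ->
  ccw_le (0, -1) ut u -> ccw_lt (0, -1) u u0 -> ccw_le (0, -1) ut u0 ->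
  (forall v, is_dir v -> ccw_le (0, -1) v u0 -> ccw_le (0, -1) ut v ->
     0 < deg M (dirQ v) P) ->
  reach (inner M P (dirQ u0)) (dirQ u0) (dirQ u) /\ inner M P (dirQ u0) (dirQ u).
Proof.
move=> P0 du0 C0 du e0P e0b we0 dP0 ltu /andP[ne leu] ltu0 HP.
have dPu : 0 < deg M (dirQ u) P by apply: HP.
have HQ w : w != 0 ->
    (if halfQ w == first_half (0, -1) u0 then 0 <= cross w (dirQ u0) else halfQ w) ->
    (if first_half (0, -1) ut == halfQ w then 0 <= cross (dirQ ut) w
     else first_half (0, -1) ut) -> 0 < deg M w P.
  move=> wn0; have [c [v [c0 dv wE]]] := dir_ray wn0; rewrite wE halfQ_ray // => h1 h2.
  rewrite (deg_scale (dirQ v)) // mulr_gt0 //; apply: HP => //; rewrite /ccw_le.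
    move: h1; case: ifP => // _.
    have -> : cross (c * v.1%:~R, c * v.2%:~R) (dirQ u0) = c * cross (dirQ v) (dirQ u0).
      by rewrite /cross /=; ring.
    by rewrite pmulr_rge0 // cross_dirQ ler0z.
  move: h2; case: ifP => // _.
  have -> : cross (dirQ ut) (c * v.1%:~R, c * v.2%:~R) = c * cross (dirQ ut) (dirQ v).
    by rewrite /cross /=; ring.
  by rewrite pmulr_rge0 // cross_dirQ ler0z.
(* If u0.(1, 1) = 0, the weight of [e0] is [u0.1] times a positive number, so positivity of the
   degree excludes (-1, 1). *)
have Cpos : 0 < u0.1 + u0.2 \/ 0 < u0.1.
  have [p|np] := ltP 0 u0.1; [by right|left].
  rewrite lt_neqAle C0 andbT eq_sym; apply/negP => /eqP z.
  move: dP0; rewrite -we0 /wgt /=.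
  have -> : u0.2 = - u0.1 by lia.
  have : (u0.1%:~R : rat) <= 0 by rewrite lerz0.
  by rewrite rmorphN /=; nra.
have unv : u.1 != 0 \/ 0 < u.2.
  have [z|] := eqVneq u.1 0; [right|by left]; rewrite ltNge; apply/negP => y0.
  have [e /deg_vert we] := vert_exists M (dirQ u) 0 P0.
  move: dPu; rewrite -we /wgt /= z mul0r add0r.
  have : (u.2%:~R : rat) <= 0 by rewrite lerz0.
  have : (0 : rat) <= e.2%:R by [].
  by nra.
have unv' : first_half (0, -1) u -> 0 < u.1.
  rewrite first_halfE => /orP[//|/andP[/eqP z neg]].
  by case: unv => [|p]; [rewrite z eqxx|move: (lt_trans neg p); rewrite ltxx].
have seg_inner w0 w1 s w2 : cross w1 w0 > 0 -> w2 = seg w0 w1 s -> 0 < s -> w2 != 0.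
  move=> cr -> s0; apply: contraTneq cr => z.
  have : cross (seg w0 w1 s) w0 = s * cross w1 w0 by rewrite /cross /seg /=; ring.
  rewrite z /cross /= !mul0r subrr => /esym/eqP; rewrite mulf_eq0 gt_eqF //= => /eqP ->.
  by rewrite ltxx.
have cvx_gt (x y s : rat) : 0 < s -> s <= 1 -> 0 <= x -> 0 < y -> 0 < (1 - s) * x + s * y.
  by move=> s0 s1 x0 y0; rewrite ltr_wpDl ?mulr_gt0 // mulr_ge0 // subr_ge0.
have cvx_lt (x y s : rat) : 0 < s -> s <= 1 -> x <= 0 -> y < 0 -> (1 - s) * x + s * y < 0.
  move=> s0 s1 x0 y0; rewrite -oppr_gt0 opprD -!mulrN.
  by apply: cvx_gt; rewrite ?oppr_ge0 ?oppr_gt0.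
have cvx_le (x s : rat) : s <= 1 -> x <= 0 -> (1 - s) * x + s * 0 <= 0.
  by move=> s1 x0; rewrite mulr0 addr0 mulr_ge0_le0 // subr_ge0.
set U := dirQ u; set U0 := dirQ u0; set T := dirQ ut.
have CQ : 0 <= U0.1 + U0.2 by rewrite /U0 /= -rmorphD ler0z.
have CposQ : 0 < U0.1 + U0.2 \/ 0 < U0.1.
  by rewrite /U0 /= -rmorphD !ltr0z.
have fin : (forall s, 0 < s <= 1 -> inner M P U0 (seg U0 U s)) -> 0 < cross U U0 ->
    reach (inner M P U0) U0 U /\ inner M P U0 U.
  move=> h cr; split; first exact: (reach_seg (reach_start _ _) cr h).
  by rewrite -(seg1 U0 U); apply: h; rewrite ltr01 lexx.
have [hh|hh] := eqVneq (first_half (0, -1) u) (first_half (0, -1) u0).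
  have cr : 0 < cross U U0.
    rewrite cross_dirQ ltr0z lt_neqAle eq_sym; apply/andP; split.
      by apply: contraNneq ne => cr; rewrite (same_half_eq du du0 hh cr).
    by move: leu; rewrite /ccw_le hh eqxx.
  apply: (fin) => // s /andP[s0 s1]; set w := seg U0 U s.
  have crw : cross w U0 = s * cross U U0 by rewrite /w /cross /seg /=; ring.
  have crw0 : 0 < cross w U0 by rewrite crw mulr_gt0.
  have hw : halfQ w = first_half (0, -1) u0.
    have [hu|hu] := boolP (first_half (0, -1) u).
      rewrite -hh hu /halfQ; apply/orP; left.
      have p1 : 0 < U.1 by rewrite /U /= ltr0z unv'.
      have p0 : 0 < U0.1.
        have hu0 : first_half (0, -1) u0 by rewrite -hh.
        rewrite /U0 /= ltr0z; move: hu0; rewrite first_halfE => /orP[//|/andP[/eqP z neg]].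
        by move: C0; rewrite z add0r leNgt neg.
      by apply: cvx_gt => //; apply: ltW.
    rewrite -hh (negbTE hu) /halfQ.
    have {}hu : U.1 < 0 \/ U.1 = 0 /\ 0 < U.2.
      move: hu; rewrite first_halfE negb_or negb_and => /andP[h1 h2].
      rewrite /U /= ltrz0 ltr0z; case: unv => [|p]; last first.
        have [z|n] := eqVneq u.1 0; first by right; rewrite z.
        by left; rewrite lt_neqAle n leNgt.
      by move=> n; left; rewrite lt_neqAle n leNgt.
    case: hu => [neg|[z p]].
      have U00 : U0.1 <= 0.
        have hu0 : ~~ first_half (0, -1) u0 by rewrite -hh; apply: contraTN neg;
          rewrite /U /= ltrz0 -leNgt => /unv'/ltW.
        by move: hu0; rewrite first_halfE negb_or /U0 /= lerz0 leNgt => /andP[].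
      have wn : w.1 < 0 by apply: cvx_lt.
      by rewrite (lt_eqF wn) orbF ltNge (ltW wn).
    have U00 : U0.1 < 0.
      move: cr; have -> : cross U U0 = U.1 * U0.2 - U.2 * U0.1 by [].
      by rewrite z mul0r sub0r oppr_gt0 pmulr_rlt0.
    have w1 : w.1 <= 0.
      have -> : w.1 = (1 - s) * U0.1 + s * U.1 by [].
      by rewrite z; apply: cvx_le => //; apply: ltW.
    have w2 : 0 < w.2 by apply: cvx_gt => //; move: CQ; lra.
    by rewrite ltNge w1 /= [_ < 0]ltNge (ltW w2) andbF.
  split.
    apply: HQ; first exact: (seg_inner U0 U s).
      by rewrite hw eqxx ltW.
    rewrite hw; case: ifP => eqh; last by move: ltu0; rewrite /ccw_le eqh.
    have -> : cross T w = (1 - s) * cross T U0 + s * cross T U.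
      by rewrite /w /cross /seg /=; ring.
    move: ltu0 ltu; rewrite /ccw_le hh eqh !(cross_dirQ) => a1 a2.
    by rewrite addr_ge0 // mulr_ge0 ?ler0z // ?subr_ge0 // ltW.
  (* The remaining case is [u0] on the ray of (1, -1); a vector clockwise of it pairs negatively
     with (1, 1), against [wC]. *)
  move=> wC; split=> //; case: CposQ => // u01.
  rewrite lt_neqAle CQ andbT eq_sym; apply/negP => /eqP z.
  have u02 : U0.2 = - U0.1 by lra.
  move: crw0; have -> : cross w U0 = w.1 * U0.2 - w.2 * U0.1 by [].
  rewrite u02; nra.
have hu : first_half (0, -1) u by move: leu; rewrite /ccw_le (negbTE hh).
have hu0 : first_half (0, -1) u0 = false.
  by move: hh; rewrite hu; case: first_half.
have ht : first_half (0, -1) ut.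
  by move: ltu; rewrite /ccw_le hu; case: first_half.
have p1 : 0 < U.1 by rewrite /U /= ltr0z unv'.
have U00 : U0.1 <= 0.
  by move: (negbT hu0); rewrite first_halfE negb_or /U0 /= lerz0 leNgt => /andP[].
have CposQ' : 0 < U0.1 + U0.2 by case: CposQ => // ?; lra.
have U02 : 0 < U0.2 by lra.
have T1 : 0 <= T.1.
  by move: ht; rewrite first_halfE /T /= ler0z => /orP[/ltW //|/andP[/eqP ->]].
have TU : 0 <= cross T U.
  by move: ltu; rewrite /ccw_le hu ht eqxx cross_dirQ ler0z.
pose N : rat * rat := (0, 1).
have rN : reach (inner M P U0) U0 N.
  have [z|n] := eqVneq U0.1 0.
    have -> : N = U0.
      rewrite /N [U0]surjective_pairing z; congr pair; rewrite /U0 /=.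
      have z' : u0.1 = 0 by apply/eqP; rewrite -(intr_eq0 rat); apply/eqP; exact: z.
      move: du0 U02; rewrite /is_dir z' /coprimez gcd0z /U0 /= ltr0z => /eqP h p.
      by suff -> : u0.2 = 1 by []; move: h p; clear; lia.
    exact: reach_start.
  have cr : 0 < cross N U0.
    have -> : cross N U0 = - U0.1 by rewrite /cross /=; ring.
    by rewrite oppr_gt0 lt_neqAle n.
  apply: (reach_seg (reach_start _ _) cr) => s /andP[s0 s1]; set w := seg U0 N s.
  have U01 : U0.1 < 0 by rewrite lt_neqAle n.
  have w1 : w.1 <= 0 by apply: cvx_le.
  have w2 : 0 < w.2 by apply: cvx_gt => //; apply: ltW.
  have crw : cross w U0 = s * cross N U0 by rewrite /w /cross /seg /=; ring.
  have crw0 : 0 < cross w U0 by rewrite crw mulr_gt0.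
  have hw : halfQ w = false.
    by rewrite /halfQ ltNge w1 /= [_ < 0]ltNge (ltW w2) andbF.
  split; last by [].
  apply: HQ; first exact: (seg_inner U0 N s).
    by rewrite hw hu0 eqxx ltW.
  by rewrite hw ht.
have cr : 0 < cross U N by have -> : cross U N = U.1 by rewrite /cross /=; ring.
have h s : 0 < s <= 1 -> inner M P U0 (seg N U s).
  move=> /andP[s0 s1]; set w := seg N U s.
  have w1 : 0 < w.1.
    have -> : w.1 = (1 - s) * 0 + s * U.1 by [].
    by rewrite mulr0 add0r mulr_gt0.
  have hw : halfQ w by rewrite /halfQ w1.
  split.
    apply: HQ; first exact: (seg_inner N U s).
      by rewrite hw hu0.
    rewrite hw ht eqxx.
    have -> : cross T w = (1 - s) * T.1 + s * cross T U.
      by rewrite /w /cross /seg /=; ring.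
    by rewrite addr_ge0 // mulr_ge0 // ?subr_ge0 // ltW.
  move=> wC; split=> //; have -> : cross w U0 = w.1 * U0.2 - w.2 * U0.1 by [].
  have [w2|w2] := leP 0 w.2; nra.
split; first exact: (reach_seg rN cr h).
by rewrite -(seg1 N U); apply: h; rewrite ltr01 lexx.
Qed.
End Arc.

(** * Application to [puiseux l K] *)

Section PuiseuxModel.
Context (l : nat) (K : fieldType).
Local Notation L := (puiseux l K).

(** Injectivity of [s] is asked only where the coefficient is nonzero, since the shift in [dy] sends
    the y-exponents 0 and 1 to the same value. *)
Lemma mcoeff_sumU (r : {fset (int * nat)%type}) (s : int * nat -> int * nat)
    (F : int * nat -> K) e k :
  s e = k -> (forall f, s f = k -> F f != 0 -> f = e) -> (e \notin r -> F e = 0) ->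
  (\sum_(f <- r) << F f *g s f >> : L)@_k = F e.
Proof.
move=> se inj ne; rewrite raddf_sum /=.
have z f : f != e -> (<< F f *g s f >> : L)@_k = 0.
  move=> fe; rewrite mcoeffU; case: (s f =P k) => //= sf; rewrite mulr1n.
  by apply: contra_neq_eq fe => /(inj _ sf) ->.
have [er|er] := boolP (e \in r).
  rewrite (big_fsetD1 e) //= mcoeffU se eqxx big1_fset ?addr0 // => f.
  by rewrite !inE => /andP[fe _] _; apply: z.
rewrite ne // big1_fset // => f fr _; apply: z.
by apply: contraNneq er => <-.
Qed.

Lemma mcoeff_dx (P : L) k :
  (dx P)@_k = (k.1 + l%:Z)%:~R / l%:R * P@_(k.1 + l%:Z, k.2).
Proof.
rewrite /dx (@mcoeff_sumU _ _ _ (k.1 + l%:Z, k.2)) //=.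
- by rewrite addrK -surjective_pairing.
- by move=> [f1 f2] /= <- _; rewrite /= subrK.
- by move=> /mcoeff_outdom ->; rewrite mulr0.
Qed.

Lemma mcoeff_dy (P : L) k : (dy P)@_k = (k.2.+1)%:R * P@_(k.1, k.2.+1).
Proof.
rewrite /dy (@mcoeff_sumU _ _ _ (k.1, k.2.+1)) //=.
- by rewrite -surjective_pairing.
- move=> [f1 [|f2]] /= <- /=; last by [].
  by rewrite mul0r eqxx.
- by move=> /mcoeff_outdom ->; rewrite mulr0.
Qed.

Lemma puiseux_coefP (c : K) (P Q : L) k : (c *: P + Q)@_k = c * P@_k + Q@_k.
Proof. by rewrite mcoeffD mcoeffZ. Qed.

Lemma puiseux_monoM (e f : int * nat) :
  (<< e >> : L) * << f >> = << (e.1 + f.1, (e.2 + f.2)%N) >>.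
Proof. by have := pmulUU l (1 : K) 1 e f; rewrite mulr1. Qed.

Definition puiseux_model : laurent_model l L :=
  @LaurentModel l K L (fun P e => P@_e) (fun e => << e >>) (fun P => msupp P)
    (@dx l K) (@dy l K) puiseux_coefP (fun P Q => (malgP P Q).1)
    (fun P => fset_uniq (msupp P)) (fun P e => esym (mcoeff_neq0 P e))
    (fun e k => mcoeffU e 1 k) (erefl _) puiseux_monoM mcoeff_dx mcoeff_dy.

Local Notation M := puiseux_model.

End PuiseuxModel.

(** * Degrees, leading forms and starting points expressed in the model *)

Section Bridge.
Context (l : nat) (l0 : (0 < l)%N) (K : fieldType).
Local Notation L := (puiseux l K).
Local Notation M := (puiseux_model l K).
Implicit Types (P : L) (u : int * int) (e f : int * nat).

Lemma vdeg_ub u P e : e \in msupp P -> ((wt u (expo l e))%:E <= vdeg u P)%E.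
Proof.
move=> eP; have eS : expo l e \in Supp P by apply: in_imfset.
have H (s : seq pt) z : z \in s -> ((wt u z)%:E <= \big[maxe/-oo%E]_(z <- s) (wt u z)%:E)%E.
  elim: s => //= z' s IH.
  by rewrite in_cons big_cons le_max => /orP[/eqP ->|/IH ->]; rewrite ?lexx ?orbT.
exact: H eS.
Qed.

Lemma vdegE u P : P != 0 -> vdeg u P = (deg M (dirQ u) P)%:E.
Proof.
move=> P0; have [e eP we] := vdeg_attained u P0; rewrite -we; congr (_%:E).
apply/esym/degE => [f fP|].
  rewrite -/(wt u (expo l e)) -lee_fin we; apply: vdeg_ub.
  by rewrite -mcoeff_neq0.
apply/eqP => /(congr1 (coef M ^~ e)); rewrite coef_part eqxx coef0 => /eqP.
by apply/negP; rewrite -mem_supp.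
Qed.

Lemma leadE u P : lead u P = ldg M (dirQ u) P.
Proof.
apply: (coef_inj M) => e; rewrite [LHS]mcoeff_lead /ldg coef_part.
have [->|P0] := eqVneq P 0; first by rewrite [coef M 0 e]coef0 [0@_e]mcoeff0 !if_same.
by rewrite vdegE.
Qed.

(** The starting point minimizes the cross product with [u] on the leading edge, so it maximizes the
    weight of [u] turned clockwise by a right angle. *)
Lemma st_vert u P : is_dir u -> P != 0 ->
  exists2 e, st u P = expo l e & vert M (dirQ u) ((dirQ u).2, - (dirQ u).1) P e.
Proof.
move=> du P0; have [sS eS s1 s2 sp] := st_en_spec du P0.
move: (sS) => /imfsetP[e /= eL sE]; exists e => //.
have eC : coef M (ldg M (dirQ u) P) e != 0 by rewrite -leadE -mem_supp.
have cr : 0 <= cross (dir_pt u) (en u P - st u P).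
  have [/s2/ltW //|] := ltnP 1 #|` Supp (lead u P)|.
  rewrite leq_eqVlt ltnS leqn0 cardfs_eq0 => /orP[/eqP/s1 ->|/eqP S0].
    by rewrite subrr /cross /= !mulr0 subrr.
  by rewrite S0 in sS.
apply/vert_ldg/(vertP M _ _ e (ldg_neq0 M _ P0)); split=> // f fP; split.
  by rewrite (ldg_hom fP) (ldg_hom eC).
move=> _; have fS : expo l f \in Supp (lead u P).
  by apply: in_imfset; rewrite leadE /= (mem_supp M).
have [t /andP[t0 _] ft] := sp _ fS.
have W g : wgt l ((dirQ u).2, - (dirQ u).1) g = - cross (dir_pt u) (expo l g).
  by rewrite /wgt /cross /expo /=; ring.
rewrite !W lerN2 -sE ft.
have -> : cross (dir_pt u) (st u P + t *: (en u P - st u P)) =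
    cross (dir_pt u) (st u P) + t * cross (dir_pt u) (en u P - st u P).
  rewrite /cross -[(st u P + _).1]/((st u P).1 + t * (en u P - st u P).1).
  by rewrite -[(st u P + _).2]/((st u P).2 + t * (en u P - st u P).2); ring.
by rewrite lerDl mulr_ge0.
Qed.

Lemma expo_inj e f : expo l e = expo l f -> e = f.
Proof.
move=> [h1 h2]; rewrite [e]surjective_pairing [f]surjective_pairing; congr pair.
  by apply/eqP; rewrite -(eqr_int rat); apply/eqP/(divIf (lQ0 l0)).
by apply/eqP; rewrite -(eqr_nat rat); apply/eqP.
Qed.

Lemma hom_homogeneous u d P : P != 0 -> hom M (dirQ u) d P -> homogeneous u P.
Proof. by move=> P0 h; rewrite /homogeneous leadE (deg_hom P0 h).2. Qed.
End Bridge.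

(** * Scalars in an algebraically closed field, and the theorem for Puiseux-type polynomials *)

Lemma root_exists (K : closedFieldType) (c : K) (k : nat) : (0 < k)%N -> exists r, r ^+ k
  = c.
Proof.
move=> k0; have : size ('X^k - c%:P) != 1%N by rewrite size_XnsubC // eqSS -lt0n.
by move/closed_rootP => [r]; rewrite rootE !hornerE subr_eq0 => /eqP; exists r.
Qed.

Lemma dirQ_sum_ge0 (u : int * int) : 0 <= u.1 + u.2 -> 0 <= (dirQ u).1 + (dirQ u).2.
Proof. by rewrite /dirQ /= -rmorphD ler0z. Qed.

Lemma ltr_diagE (l : nat) (x : int) (y : nat) : (0 < l)%N ->
  (y%:R < x%:~R / l%:R :> rat) = (l%:Z * y%:Z < x).
Proof. by move=> l0; rewrite ltr_pdivlMr ?ltr0n // -natrM pmulrn ltr_int PoszM mulrC. Qed.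

Lemma expo_ratio (l q p : nat) (a : int) (b : nat) (e : int * nat) :
  (0 < l)%N -> (0 < q)%N ->
  expo l e = (p%:R / q%:R : rat) *: ((a%:~R / l%:R, b%:R) : pt) ->
  e.1 *+ q = a *+ p /\ (e.2 * q = b * p)%N.
Proof.
move=> l0 q0; have lQn := lQ0 l0; have qn0 : (q%:R : rat) != 0 by rewrite pnatr_eq0 -lt0n.
move=> -[].
rewrite -[X in _ = X -> _]/(p%:R / q%:R * (a%:~R / l%:R)) => h1.
rewrite -[X in _ = X -> _]/(p%:R / q%:R * b%:R) => h2; split.
  apply/eqP; rewrite -(eqr_int rat); apply/eqP.
  have {}h1 : e.1%:~R = p%:R / q%:R * a%:~R :> rat.
    by apply: (divIf lQn); rewrite h1; ring.
  by rewrite !rmorphMn /= h1 -[LHS]mulr_natl -[RHS]mulr_natl mulrA [q%:R * _]mulrC divfK.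
apply/eqP; rewrite -(eqr_nat rat) !natrM h2; apply/eqP.
by rewrite mulrAC divfK // mulrC.
Qed.

Theorem corollary7p4 (K : closedFieldType) (l m n : nat) (P Q : puiseux l K)
    (u0 ut : int * int) (a : int) (b : nat) (F G0 : puiseux l K) (p q : nat) :
  [pchar K] =i pred0 ->
  (0 < l)%N -> (1 < m)%N -> (1 < n)%N -> coprime m n ->
  (exists2 c : K, c != 0 & bracket P Q = c%:A) ->
  fine (vdeg (1, 1) P) / fine (vdeg (1, 1) Q) = m%:R / n%:R ->
  fine (vdeg (0, 1) P) / fine (vdeg (0, 1) Q) = m%:R / n%:R ->
  is_dir_ge0 u0 ->
  u0 \in Dir P -> (0 < vdeg u0 P)%E ->
  (m%:R^-1 : rat) *: st u0 P = (a%:~R / l%:R, b%:R) ->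
  (n%:R^-1 : rat) *: st u0 Q = (a%:~R / l%:R, b%:R) ->
  (0 < b)%N ->
  (b%:R < a%:~R / l%:R :> rat) ->
  is_min_dir (0, -1)
    (fun u => [/\ u \in Dir P, u \in ccw_arc (0, -1) u0
      & forall w, w \in ccw_arc (0, -1) u0 -> ccw_le (0, -1) u w -> (0 < vdeg w P)%E])
    ut ->
  homogeneous u0 F ->
  subalg_gen P Q G0 -> G0 != 0 ->
  vdeg u0 F = ((u0.1 + u0.2)%:~R)%:E ->
  bracket F (lead u0 P) = lead u0 P ->
  bracket (lead u0 G0) (lead u0 P) * F = lead u0 G0 * lead u0 P ->
  (forall i : nat, (0 < i)%N ->
    bracket (lead u0 (iter i (fun G => bracket G P) G0)) (lead u0 P) = 0) ->
  (0 < p)%N -> (0 < q)%N -> coprime p q ->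
  st u0 F = (p%:R / q%:R : rat) *: ((a%:~R / l%:R, b%:R) : pt) ->
  forall u : int * int, is_dir u ->
    ccw_le (0, -1) ut u -> ccw_lt (0, -1) u u0 ->
    exists R : puiseux l K, homogeneous u R /\ lead u P = R ^+ (q * m).
Proof.
move=> ch0 l0 m1 n1 mn [c c0 bPQ] _ _ /andP[du0 C0] _ dP0 stP stQ b0 lba [[_ /andP[_
  utu0] HP] _].
move=> homF gen G00 _ bF GF Gi p0 q0 pq stF u du utu uu0.
pose M := puiseux_model l K; have m0 := ltnW m1; have n0 := ltnW n1.
have cA : c%:A != 0 :> puiseux l K by rewrite scaler_eq0 negb_or c0 oner_eq0.
have P0 : P != 0 by apply: contraNneq cA => E; apply/eqP; rewrite -bPQ E; exact: (brk0l M).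
have Q0 : Q != 0 by apply: contraNneq cA => E; apply/eqP; rewrite -bPQ E; exact: (brk0r M).
have lP0 : lead u0 P != 0 by rewrite leadE ldg_neq0.
(* [F] is nonzero because its bracket with the leading form of [P] is that nonzero leading form. *)
have F0 : F != 0.
  by apply: contraNneq lP0 => E; apply/eqP; rewrite -bF E; exact: (brk0l M).
have [eP stPe vP] := st_vert du0 P0; have [eQ stQe vQ] := st_vert du0 Q0.
have [eF stFe vF] := st_vert du0 F0.
have vertE (X : puiseux l K) k e v : (0 < k)%N ->
    (k%:R^-1 : rat) *: st u0 X = (a%:~R / l%:R, b%:R) -> st u0 X = expo l e ->
    vert M (dirQ u0) v X e -> vert M (dirQ u0) v X (a *+ k, (b * k)%N).
  move=> k0 sX sXe; suff -> : e = (a *+ k, (b * k)%N) by [].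
  have kn0 : (k%:R : rat) != 0 by rewrite pnatr_eq0 -lt0n.
  apply: (expo_inj l0); rewrite -sXe -[LHS]scale1r -(mulfV kn0) -scalerA sX /expo /=.
  congr pair; first by rewrite -[_ *: _]/(k%:R * (a%:~R / l%:R)) rmorphMn /= mulrA
    mulr_natl.
  by rewrite -[_ *: _]/(k%:R * b%:R) natrM mulrC.
have [eF1 eF2] := expo_ratio l0 q0 (etrans (esym stFe) stF).
have dP : 0 < deg M (dirQ u0) P by move: dP0; rewrite (vdegE _ P0) lte_fin.
have lbaZ : l%:Z * b%:Z < a by rewrite -(ltr_diagE _ _ l0).
have un0 : u0 != 0 by apply: contraTneq du0 => ->.
have u'n0 : u != 0 by apply: contraTneq du => ->.
have d0n0 : dirQ u0 != 0.
  by apply: contra_neq un0 => -[]/eqP + /eqP; rewrite !intr_eq0 => /eqP h1 /eqP h2;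
     rewrite [u0]surjective_pairing h1 h2.
have vP' := vertE P m eP _ m0 stP stPe vP; have vQ' := vertE Q n eQ _ n0 stQ stQe vQ.
have [eP0 weP _ _] := vert_spec vP'.
have e0b : ((b * m)%N)%:R < (a *+ m)%:~R / l%:R :> rat.
  by rewrite (ltr_diagE _ _ l0) -[a *+ m]mulr_natr natz PoszM mulrA (ltr_pM2r (m0 : 0 <
    m%:Z)).
have [rd id] : reach (inner M P (dirQ u0)) (dirQ u0) (dirQ u) /\ inner M P (dirQ u0)
  (dirQ u).
  apply: (arc_reach l0 P0 du0 C0 du eP0 e0b weP dP utu uu0 utu0) => v dv vu0 utv.
  have := HP v; rewrite (vdegE _ P0) lte_fin inE dv vu0 => h.
  exact: (h isT utv).
have bPQ' : brk M P Q = c%:A by exact: bPQ.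
have GF' : brk M (ldg M (dirQ u0) G0) (ldg M (dirQ u0) P) * F =
    ldg M (dirQ u0) G0 * ldg M (dirQ u0) P.
  by rewrite -!leadE; exact: GF.
have Gi' i : (0 < i)%N ->
    brk M (ldg M (dirQ u0) (iter i (fun G => brk M G P) G0)) (ldg M (dirQ u0) P) = 0.
  by move=> i0; rewrite -!leadE; exact: Gi.
have hF : hom M (dirQ u0) (deg M (dirQ u0) F) F.
  by rewrite {2}homF leadE; apply: ldg_hom.
have CQ := dirQ_sum_ge0 C0.
have [R [c' [c'0 RE [dR hR]]]] := model_power l0 ch0 P0 Q0 bPQ' (cross_perp d0n0) vP' vQ'
  hF vF eF1 eF2
  dP CQ b0 lbaZ m0 n0 p0 q0 mn pq gen G00 GF' Gi' u'n0 id rd.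
(* The scalar has a root of order q m in [K], which is absorbed into [R]. *)
have [r rE] : exists r, r ^+ (q * m) = c' by apply: root_exists; rewrite muln_gt0 q0.
have E : lead u P = (r *: R) ^+ (q * m) by rewrite leadE exprZn rE.
exists (r *: R); split; last exact: E.
apply: (hom_homogeneous (d := dR)); last exact: supportedZ hR.
apply: contra_neq (ldg_neq0 M (dirQ u) P0) => R0.
by rewrite -leadE E R0 expr0n muln_eq0 (gtn_eqF q0) (gtn_eqF m0).
Qed.
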